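(* Let $K$ be a finite ordered simplicial complex of pure dimension $m$ and, for each top-dimensional simplex $\Delta\in K$, let $\mathcal{R}_\Delta\subset J^1(\Delta,\mathbb{R}^n)$ be an open and fiberwise dense differential relation; write $\mathcal{R}=\{\mathcal{R}_\Delta\}$. Then for every $\epsilon>0$ and every map $s:|K|\to\mathbb{R}^n$ that is piecewise smooth with respect to $K$, there exist $\ell\in\mathbb{N}$ and an $\epsilon$-jiggling $(s',K_\ell)$ of $(s,K)$ such that $s'$ is piecewise linear with respect to the $\ell$th crystalline subdivision $K_\ell$ of $K$, and $s'$ is a piecewise solution of $\mathcal{R}$.
   Context: A simplicial complex is a locally finite set of linear simplices in $\mathbb{R}^N$ closed under faces with pairwise intersections common faces; it is ordered if its vertex set is totally ordered (so each simplex is ordered), and of pure dimension $m$ if every simplex is a face of an $m$-simplex. Crystalline subdivision: for an ordered linear $m$-simplex $\Delta=\langle v_0,\dots,v_m\rangle$ with $m>0$, let $\iota:\Delta\to[0,1]^m$ be the affine map with $\iota(v_j)=(0,\dots,0,1,\dots,1)$ ($j$ zeros followed by $m-j$ ones); subdivide $[0,1]^m$ into $2^{\ell m}$ cubes of side $2^{-\ell}$ and each such cube into the $m!$ simplices that are rescaled translates of $\{0\le x_{\pi(1)}\le\dots\le x_{\pi(m)}\le 1\}$, $\pi$ a permutation; pulling back via $\iota$ gives the $\ell$th crystalline subdivision of $\Delta$ (a $0$-simplex is its own subdivision), and $K_\ell$ is the union of those of all simplices of $K$. A map is piecewise smooth (resp. piecewise linear) with respect to a complex if it is continuous and smooth (resp.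 affine) on each of its simplices. For $\Delta\in K$ top-dimensional, $J^1(\Delta,\mathbb{R}^n)$ is the 1-jet space of maps $\Delta\to\mathbb{R}^n$; fiberwise dense means that over each point $(x,y)\in\Delta\times\mathbb{R}^n$ the set of slopes $A\in\operatorname{Hom}(\mathbb{R}^m,\mathbb{R}^n)$ with $(x,y,A)\in\mathcal{R}_\Delta$ is dense. Relations pull back to the simplices of a subdivision, and a map piecewise smooth with respect to $K_\ell$ is a piecewise solution if on every top simplex of $K_\ell$ (contained in $\Delta\in K$) its 1-jet lies in $\mathcal{R}_\Delta$. For maps $f_1,f_2$ piecewise smooth with respect to $K_1,K_2$, $d_{C^1}(f_1,f_2)<\epsilon$ means that on every top simplex of a common subdivision of $K_1,K_2,K$ the restrictions are $C^1$-close with respect to the Euclidean metric. $(f_2,K_2)$ is an $\epsilon$-jiggling of $(f_1,K_1)$ if $K_2$ subdivides $K_1$ and $d_{C^1}(f_1,f_2)<\epsilon$. *)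

(* Defs.v *)
From HB Require Import structures.
From mathcomp Require Import all_boot all_order all_algebra all_fingroup.
From mathcomp Require Import all_classical all_reals all_analysis.

Set Implicit Arguments.
Unset Strict Implicit.
Unset Printing Implicit Defensive.

Import Order.TTheory GRing.Theory Num.Theory.
Import numFieldNormedType.Exports.
Local Open Scope classical_set_scope.
Local Open Scope ring_scope.

(* Encoding of a finite ordered simplicial complex of pure dimension m  *)
(* in R^N (points are row vectors 'rV[R]_N):                            *)
(*  - V : 'I_p -> 'rV_N  the vertices; the total order on vertices is   *)
(*    the order of the indices 'I_p;                                    *)
(*  - top : 'I_q -> 'I_m.+1 -> 'I_p  the top-dimensional (m-)simplices, *)
(*    top i j being the index of the j-th vertex of the i-th top        *)
(*    simplex (vertices listed in increasing order).                    *)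
(* The complex K is the set of all faces (nonempty vertex subsets) of    *)
(* the top simplices; hence it is closed under faces and pure of        *)
(* dimension m by construction.                                         *)

Section Defs.
Variable R : realType.

Definition conv_idx (N p : nat) (V : 'I_p -> 'rV[R]_N) (F : {set 'I_p})
  : set 'rV[R]_N :=
  [set x | exists lam : 'I_p -> R,
      (forall k, 0 <= lam k) /\ (forall k, k \notin F -> lam k = 0) /\
      \sum_k lam k = 1 /\ x = \sum_k lam k *: V k].

Definition top_set (m p q : nat) (top : 'I_q -> 'I_m.+1 -> 'I_p) (i : 'I_q)
  : {set 'I_p} := [set top i j | j : 'I_m.+1].

Definition edge_mx (N m : nat) (v : 'I_m.+1 -> 'rV[R]_N) : 'M[R]_(m, N) :=
  \matrix_(j < m, k < N) (v (lift ord0 j) - v ord0) 0 k.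

Definition phi (N m : nat) (v : 'I_m.+1 -> 'rV[R]_N) (t : 'rV[R]_m)
  : 'rV[R]_N := v ord0 + t *m edge_mx v.

Definition std_simplex (m : nat) : set 'rV[R]_m :=
  [set t | (forall j, 0 <= t 0 j) /\ \sum_j t 0 j <= 1].

Definition simplex_set (N m : nat) (v : 'I_m.+1 -> 'rV[R]_N) : set 'rV[R]_N :=
  phi v @` @std_simplex m.

Definition simplicial_complex (N m p q : nat) (V : 'I_p -> 'rV[R]_N)
    (top : 'I_q -> 'I_m.+1 -> 'I_p) : Prop :=
  (forall i (j k : 'I_m.+1), (j < k)%N -> (top i j < top i k)%N) /\
  (forall i i', (forall j, top i j = top i' j) -> i = i') /\
  (forall i, row_free (edge_mx (fun j => V (top i j)))) /\
  (forall i1 i2 (F1 F2 : {set 'I_p}),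
      (0 < #|F1|)%N -> F1 \subset top_set top i1 ->
      (0 < #|F2|)%N -> F2 \subset top_set top i2 ->
      exists F : {set 'I_p}, F \subset F1 /\ F \subset F2 /\
        conv_idx V F1 `&` conv_idx V F2 = conv_idx V F).

Definition polyhedron (N m p q : nat) (V : 'I_p -> 'rV[R]_N)
    (top : 'I_q -> 'I_m.+1 -> 'I_p) : set 'rV[R]_N :=
  \bigcup_(i in setT) simplex_set (fun j => V (top i j)).

Definition iterD (m n : nat) (vs : seq 'rV[R]_m) (g : 'rV[R]_m -> 'rV[R]_n)
  : 'rV[R]_m -> 'rV[R]_n :=
  foldr (fun v h => 'D_v h) g vs.

Definition smooth_on (m n : nat) (U : set 'rV[R]_m) (g : 'rV[R]_m -> 'rV[R]_n)
  : Prop :=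
  forall (vs : seq 'rV[R]_m) (t : 'rV[R]_m), U t ->
    (forall w, derivable (iterD vs g) t w) /\ {for t, continuous (iterD vs g)}.

Definition smooth_extension (N m n : nat) (v : 'I_m.+1 -> 'rV[R]_N)
    (f : 'rV[R]_N -> 'rV[R]_n) (g : 'rV[R]_m -> 'rV[R]_n) : Prop :=
  exists U : set 'rV[R]_m, open U /\ @std_simplex m `<=` U /\ smooth_on U g /\
    forall t, @std_simplex m t -> f (phi v t) = g t.

Definition smooth_on_simplex (N m n : nat) (v : 'I_m.+1 -> 'rV[R]_N)
    (f : 'rV[R]_N -> 'rV[R]_n) : Prop :=
  exists g, smooth_extension v f g.

Definition jac (m n : nat) (g : 'rV[R]_m -> 'rV[R]_n) (t : 'rV[R]_m)
  : 'M[R]_(m, n) :=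
  \matrix_(j < m, k < n) ('D_(delta_mx 0 j) g t) 0 k.

Definition piecewise_smooth (N m n p q : nat) (V : 'I_p -> 'rV[R]_N)
    (top : 'I_q -> 'I_m.+1 -> 'I_p) (f : 'rV[R]_N -> 'rV[R]_n) : Prop :=
  {within polyhedron V top, continuous f} /\
  forall i, smooth_on_simplex (fun j => V (top i j)) f.

Definition eucl (a b : nat) (A : 'M[R]_(a, b)) : R :=
  Num.sqrt (\sum_i \sum_j A i j ^+ 2).

(* J^1(Delta, R^n) = Delta x R^n x Hom(R^m, R^n); slopes A : 'M_(m,n)  *)
(* are expressed in the affine coordinates phi v of Delta.            *)
Definition jet_space (N m n : nat) (v : 'I_m.+1 -> 'rV[R]_N)
  : set ('rV[R]_N * 'rV[R]_n * 'M[R]_(m, n)) :=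
  [set x | simplex_set v x.1.1].

Definition open_relation (N m n : nat) (v : 'I_m.+1 -> 'rV[R]_N)
    (Rl : set ('rV[R]_N * 'rV[R]_n * 'M[R]_(m, n))) : Prop :=
  Rl `<=` jet_space v /\
  exists O, open O /\ Rl = O `&` jet_space v.

Definition fiberwise_dense (N m n : nat) (v : 'I_m.+1 -> 'rV[R]_N)
    (Rl : set ('rV[R]_N * 'rV[R]_n * 'M[R]_(m, n))) : Prop :=
  forall x y, simplex_set v x -> dense [set A | Rl (x, y, A)].

Definition cube_simplex (m l : nat) (c : 'I_m -> 'I_(2 ^ l)) (pi : {perm 'I_m})
  : set 'rV[R]_m :=
  [set x | exists y : 'rV[R]_m,
     (forall a, 0 <= y 0 a <= 1) /\
     (forall a b : 'I_m, (a <= b)%N -> y 0 (pi a) <= y 0 (pi b)) /\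
     x = (2 ^+ l)^-1 *: (\row_a ((c a : nat)%:R) + y)].

Definition iota_simplex (m : nat) : set 'rV[R]_m :=
  [set x | (forall a, 0 <= x 0 a <= 1) /\
           (forall a b : 'I_m, (a <= b)%N -> x 0 a <= x 0 b)].

(* iota^-1 : the affine map sending (0^j 1^(m-j)) to v_j *)
Definition iota_inv (N m : nat) (v : 'I_m.+1 -> 'rV[R]_N) (x : 'rV[R]_m)
  : 'rV[R]_N :=
  let xs := 0 :: [seq x 0 a | a <- enum 'I_m] ++ [:: 1] in
  \sum_(j < m.+1) (nth 0 xs j.+1 - nth 0 xs j) *: v j.

(* The top simplices of the l-th crystalline subdivision of the top  *)
(* simplex v are the sets crystal_simplex v l c pi with               *)
(* @cube_simplex m l c pi `<=` @iota_simplex m.                           *)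
Definition crystal_simplex (N m l : nat) (v : 'I_m.+1 -> 'rV[R]_N)
    (c : 'I_m -> 'I_(2 ^ l)) (pi : {perm 'I_m}) : set 'rV[R]_N :=
  iota_inv v @` @cube_simplex m l c pi.

Definition affine_on (N n : nat) (tau : set 'rV[R]_N) (f : 'rV[R]_N -> 'rV[R]_n)
    (M : 'M[R]_(N, n)) (b : 'rV[R]_n) : Prop :=
  forall z, tau z -> f z = z *m M + b.

Definition piecewise_linear_crystal (N m n p q : nat) (V : 'I_p -> 'rV[R]_N)
    (top : 'I_q -> 'I_m.+1 -> 'I_p) (l : nat) (f : 'rV[R]_N -> 'rV[R]_n)
  : Prop :=
  {within polyhedron V top, continuous f} /\
  forall i c pi, @cube_simplex m l c pi `<=` @iota_simplex m ->
    exists M b, affine_on (crystal_simplex (fun j => V (top i j)) c pi) f M b.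

(* f' (piecewise linear w.r.t. K_l) is a piecewise solution of the   *)
(* relations Rl: on each top simplex tau of K_l, contained in the top *)
(* simplex i of K, the 1-jet (z, f' z, slope) lies in Rl i, the slope *)
(* of the affine map z |-> z M + b being edge_mx v *m M in the        *)
(* coordinates phi v.                                                 *)
Definition piecewise_solution_crystal (N m n p q : nat) (V : 'I_p -> 'rV[R]_N)
    (top : 'I_q -> 'I_m.+1 -> 'I_p) (l : nat)
    (Rl : 'I_q -> set ('rV[R]_N * 'rV[R]_n * 'M[R]_(m, n)))
    (f : 'rV[R]_N -> 'rV[R]_n) : Prop :=
  forall i c pi, @cube_simplex m l c pi `<=` @iota_simplex m ->
    let v := fun j => V (top i j) in
    exists M b, affine_on (crystal_simplex v c pi) f M b /\
      forall z, crystal_simplex v c pi z -> Rl i (z, f z, edge_mx v *m M).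

(* d_C1(f, f') < eps, computed on the top simplices of K_l (the common *)
(* subdivision of K and K_l), where f is piecewise smooth w.r.t. K and *)
(* f' piecewise linear w.r.t. K_l.                                     *)
Definition C1_close_crystal (N m n p q : nat) (V : 'I_p -> 'rV[R]_N)
    (top : 'I_q -> 'I_m.+1 -> 'I_p) (l : nat) (eps : R)
    (f f' : 'rV[R]_N -> 'rV[R]_n) : Prop :=
  forall i c pi, @cube_simplex m l c pi `<=` @iota_simplex m ->
    let v := fun j => V (top i j) in
    forall g, smooth_extension v f g ->
    exists M b, affine_on (crystal_simplex v c pi) f' M b /\
      forall t, @std_simplex m t -> crystal_simplex v c pi (phi v t) ->
        eucl (g t - f' (phi v t)) < eps /\
        eucl (jac g t - edge_mx v *m M) < eps.

End Defs.

(* Main.v *)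
(** Barycentric coordinates on K, ordered and summed up, embed |K| in R^p so
    that the crystalline subdivision is induced by the Freudenthal triangulation
    of 2^-l Z^p. A map that is linear on each simplex of K_l is thus a
    combination of explicit hat functions, with arbitrary values at the vertices,
    and no gluing is needed.

    Interpolating s at the vertices of K_l gives a C^1 approximation when l is
    large. Its vertex values are then moved by O(2^-l), which moves the slopes
    by O(1), uniformly in l. Simplices with the same top simplex of K, the same
    permutation and the same parity of their cube have no common vertex, so their
    slopes can be prescribed independently: the number of such classes does not
    depend on l, and they are corrected one after the other. By compactness of
    the jets near j^1 s, for every e there is r such that each slope is
    e-close to the centre of an r-ball of slopes that are good at all jets over
    an r-neighbourhood. Each correction is small compared with the radii
    obtained in the previous ones; l is chosen after all the radii. *)

Require Import Defs.
From HB Require Import structures.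
From mathcomp Require Import all_boot all_order all_algebra all_fingroup.
From mathcomp Require Import all_classical all_reals all_analysis.
From mathcomp Require Import ring lra zify.
Import Order.TTheory GRing.Theory Num.Theory.
Import numFieldNormedType.Exports.
Local Open Scope classical_set_scope.
Local Open Scope ring_scope.

Set Implicit Arguments.
Unset Strict Implicit.
Unset Printing Implicit Defensive.

(** * Barycentric coordinates and hat functions *)

Section BoundedNodes.
Variables (T : Type) (m : nat).

(** The list has the shape of [xs] in [iota_inv]. It is polymorphic because it also serves, over the
    naturals, for the corner of a cube and for ranks in a permutation. *)
Definition bnode (a b : T) (f : 'I_m -> T) (j : nat) : T :=
  nth a (a :: [seq f k | k <- enum 'I_m] ++ [:: b]) j.

Lemma bnodeS a b f (k : 'I_m) : bnode a b f k.+1 = f k.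
Proof.
rewrite /bnode /= nth_cat size_map size_enum_ord ltn_ord.
by rewrite (nth_map k) ?size_enum_ord // nth_ord_enum.
Qed.

Lemma bnode_last a b f : bnode a b f m.+1 = b.
Proof. by rewrite /bnode /= nth_cat size_map size_enum_ord ltnn subnn. Qed.

End BoundedNodes.

Lemma bnode_cases (m s : nat) : (s <= m.+1)%N ->
  [\/ s = 0%N, exists a : 'I_m, s = a.+1 | s = m.+1].
Proof.
case: s => [_|s]; first by constructor 1.
rewrite ltnS leq_eqVlt => /predU1P[->|sm]; first by constructor 3.
by constructor 2; exists (Ordinal sm).
Qed.

Section Barycentric.
Variable R : realType.

Definition bary m (t : 'rV[R]_m) (j : 'I_m.+1) : R :=
  if unlift ord0 j is Some k then t 0 k else 1 - \sum_k t 0 k.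

Lemma bary0 m (t : 'rV[R]_m) : bary t ord0 = 1 - \sum_k t 0 k.
Proof. by rewrite /bary unlift_none. Qed.

Lemma baryS m (t : 'rV[R]_m) k : bary t (lift ord0 k) = t 0 k.
Proof. by rewrite /bary liftK. Qed.

Lemma sum_bary m (t : 'rV[R]_m) : \sum_j bary t j = 1.
Proof.
by rewrite big_ord_recl; under eq_bigr do rewrite baryS; rewrite bary0 subrK.
Qed.

Lemma bary_ge0 m (t : 'rV[R]_m) j : std_simplex t -> 0 <= bary t j.
Proof.
case=> t0 t1; rewrite /bary; case: unlift => [k|]; first exact: t0.
by rewrite subr_ge0.
Qed.

Lemma phi_bary N m (v : 'I_m.+1 -> 'rV[R]_N) t :
  phi v t = \sum_j bary t j *: v j.
Proof.
rewrite big_ord_recl bary0 scalerBl scale1r -addrA; congr (_ + _).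
rewrite mulmx_sum_row scaler_suml -sumrN -big_split /=; apply: eq_bigr => k _.
rewrite baryS addrC -scalerBr; congr (_ *: _).
by apply/rowP => a; rewrite !mxE.
Qed.

Definition node m (x : 'rV[R]_m) (j : nat) : R := bnode 0 1 (x 0) j.

Lemma nodeS m (x : 'rV[R]_m) (a : 'I_m) : node x a.+1 = x 0 a.
Proof. exact: bnodeS. Qed.

Lemma node_last m (x : 'rV[R]_m) : node x m.+1 = 1.
Proof. exact: bnode_last. Qed.

Lemma node_le m (x : 'rV[R]_m) (j : nat) :
  iota_simplex x -> (j <= m)%N -> node x j <= node x j.+1.
Proof.
move=> [x01 xle]; case: j => [|j] jm.
  case: m x x01 xle {jm} => [|m] x x01 xle; first by rewrite node_last ler01.
  by rewrite (nodeS x ord0); case/andP: (x01 ord0).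
rewrite (nodeS x (Ordinal jm)).
have [jm1|jm1] := ltnP j.+1 m; first by rewrite (nodeS x (Ordinal jm1)) xle /=.
have -> : j.+2 = m.+1 by apply/eqP; rewrite eqSS eqn_leq jm jm1.
by rewrite node_last; case/andP: (x01 (Ordinal jm)).
Qed.

(* The coordinates [t] of [phi] as a function of the coordinates of [iota]. *)
Definition tcoord m (x : 'rV[R]_m) : 'rV[R]_m :=
  \row_j (node x j.+2 - node x j.+1).

Lemma bary_tcoord m (x : 'rV[R]_m) (j : 'I_m.+1) :
  bary (tcoord x) j = node x j.+1 - node x j.
Proof.
case: (unliftP ord0 j) => [k|] ->; first by rewrite baryS mxE.
rewrite bary0; under eq_bigr do rewrite mxE.
rewrite -(big_mkord xpredT (fun k => node x k.+2 - node x k.+1)).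
by rewrite (telescope_sumr (fun k => node x k.+1)) // node_last subr0 opprB subrKC.
Qed.

Lemma iota_inv_phi N m (v : 'I_m.+1 -> 'rV[R]_N) x :
  iota_inv v x = phi v (tcoord x).
Proof. by rewrite phi_bary; apply: eq_bigr => j _; rewrite bary_tcoord. Qed.

Lemma tcoord_std m (x : 'rV[R]_m) : iota_simplex x -> std_simplex (tcoord x).
Proof.
move=> xi; split=> [j|]; first by rewrite mxE subr_ge0 node_le.
rewrite -subr_ge0 -bary0 bary_tcoord subr_ge0; exact: node_le.
Qed.

Definition lower_mx m : 'M[R]_m := \matrix_(j, a) (a <= j)%N%:R.

(** The tail sums of [tcoord x] telescope down from the last node, which is 1. Hence [- lower_mx] is
    the linear part of the inverse of [tcoord]. *)
Lemma tcoordK m (x : 'rV[R]_m) : const_mx 1 - tcoord x *m lower_mx m = x.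
Proof.
apply/rowP => a; rewrite !mxE.
have -> : \sum_j tcoord x 0 j * lower_mx m j a = 1 - x 0 a; last first.
  by rewrite opprB subrKC.
rewrite -nodeS -(node_last x) -(telescope_sumr (fun k => node x k.+1)); last first.
  exact: ltnW.
rewrite big_geq_mkord /= [RHS]big_mkcond /=; apply: eq_bigr => j _.
by rewrite !mxE; case: leqP => _; rewrite ?mulr1 ?mulr0.
Qed.

End Barycentric.

Section Hat.
Variables (R : realType) (p : nat).

(* The nodal basis function at the origin of the Freudenthal triangulation of *)
(* R^p with vertex set Z^p.                                                   *)
Definition hat (d : 'I_p -> R) : R :=
  Num.max 0 (1 - \big[Num.max/0]_k d k + \big[Num.min/0]_k d k).

Variables (m : nat) (mu : 'I_m.+1 -> R) (B W theta : 'I_p -> nat).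
Hypotheses (mu_ge0 : forall t, 0 <= mu t) (sum_mu : \sum_t mu t = 1).

Let M s := \sum_(t < m.+1 | (t < s)%N) mu t.

Let M_le s s' : (s <= s')%N -> M s <= M s'.
Proof.
move=> ss'; rewrite /M [leLHS]big_mkcond [leRHS]big_mkcond; apply: ler_sum => t _.
by case: (ltnP t s) => [ts|_]; [rewrite (leq_trans ts ss')|case: ifP].
Qed.

Let M0 : M 0 = 0. Proof. exact: big_pred0. Qed.

Let M1 : M m.+1 = 1.
Proof. by rewrite -sum_mu; apply: eq_bigl => t; rewrite ltn_ord. Qed.

Let M_ge0 s : 0 <= M s. Proof. by rewrite -M0 M_le. Qed.

Let M_le1 s : M s <= 1.
Proof.
by rewrite -sum_mu [leLHS]big_mkcond; apply: ler_sum => t _; case: ifP.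
Qed.

(* In a cube, the vertices [B + (t < theta)] form a chain; the point with     *)
(* barycentric coordinates [mu] with respect to it has coordinates            *)
(* [B + M theta], and the hat function at [W] recovers the weight of [W].     *)
Lemma hat_chain :
  hat (fun k => (B k)%:R + \sum_(t < m.+1 | (t < theta k)%N) mu t - (W k)%:R) =
  \sum_(t < m.+1 | [forall k, W k == (B k + (t < theta k))%N]) mu t.
Proof.
under [in LHS]eq_fun do rewrite -/(M _).
set d := fun k => _.
(* If some [W k] is neither [B k] nor [B k + 1], then [W] is no vertex of the chain and some [d k]
   is at least 1 or at most -1. Since 0 takes part in both the maximum and the minimum, the hat
   vanishes. *)
have [/forallP Wg|/forallPn[k0]] :=
  boolP [forall k, (W k == B k) || (W k == (B k).+1)]; last first.
  rewrite negb_or => /andP[Wk0 Wk1].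
  rewrite [RHS]big_pred0; last first.
    move=> t; apply/negbTE/forallPn; exists k0.
    by case: ltnP; rewrite ?addn0 ?addn1.
  rewrite /hat; apply/max_idPl.
  have [WB|BW] := ltnP (W k0) (B k0).
    have : 1 <= \big[Num.max/0]_k d k.
      apply: (@le_trans _ _ (d k0)); last exact: le_bigmax.
      have : (W k0).+1%:R <= (B k0)%:R :> R by rewrite ler_nat.
      by have := M_ge0 (theta k0); rewrite /d -natr1; lra.
    have : \big[Num.min/0]_k d k <= 0 by exact: bigmin_le_id.
    lra.
  have : \big[Num.min/0]_k d k <= -1.
    apply: (@le_trans _ _ (d k0)); first exact: bigmin_le.
    have : (B k0).+2%:R <= (W k0)%:R :> R by rewrite ler_nat; lia.
    by have := M_le1 (theta k0); rewrite /d -!natr1; lra.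
  have : 0 <= \big[Num.max/0]_k d k by exact: bigmax_ge_id.
  lra.
(* [W] is the vertex number [t] exactly when [T0 <= t < T1], and the hat is the positive part of
   [M T1 - M T0]. [T1] is a minimum of [theta], written through complements so that it is [m.+1]
   over the empty set. *)
pose T0 := \max_(k | W k == B k) theta k.
pose T1 := (m.+1 - \max_(k | W k != B k) (m.+1 - theta k))%N.
have T1_le k : W k != B k -> (T1 <= theta k)%N.
  move=> WB; have := @leq_bigmax_cond _ (fun k => W k != B k) (fun k => m.+1 - theta k)%N k WB.
  by rewrite /T1; lia.
have dE k : d k = if W k == B k then M (theta k) else M (theta k) - 1.
  rewrite /d; have := Wg k; case: eqP => [->|_ /= /eqP->].
    by rewrite addrAC subrr add0r.
  by rewrite -natr1; lra.
rewrite /hat.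
have -> : \big[Num.max/0]_k d k = M T0.
  apply/le_anti/andP; split.
    apply/bigmax_leP; split=> [|k _]; first exact: M_ge0.
    rewrite dE; case: ifP => WB; last first.
      by have := M_le1 (theta k); have := M_ge0 T0; lra.
    apply: M_le; exact: leq_bigmax_cond.
  rewrite /T0; elim/big_ind: _ => [|a b|k WB].
  - by rewrite M0 bigmax_ge_id.
  - by case: (leqP a b).
  - by apply: le_trans (le_bigmax _ _ k); rewrite dE WB.
have -> : \big[Num.min/0]_k d k = M T1 - 1.
  apply/le_anti/andP; split.
    rewrite lerBrDr /T1; elim/big_ind: _ => [|a b|k WB].
    - by rewrite subn0 M1 gerDr bigmin_le_id.
    - by case: (leqP a b).
    - rewrite -lerBrDr (le_trans (bigmin_le _ k _)) // dE (negbTE WB) lerB //.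
      have [le1|le1] := leqP (theta k) m.+1; first by rewrite subKn.
      by rewrite (_ : m.+1 - theta k = 0)%N ?subn0 ?M1 //; lia.
  apply/bigmin_geP; split=> [|k _]; first by rewrite subr_le0.
  rewrite dE; case: ifP => WB.
    by have := M_le1 T1; have := M_ge0 (theta k); lra.
  by rewrite lerB // M_le // T1_le // WB.
have PE (t : 'I_m.+1) :
    [forall k, W k == (B k + (t < theta k))%N] = (T0 <= t < T1)%N.
  apply/forallP/andP => [Wt|[T0t tT1] k]; first split.
  - by apply/bigmax_leqP => k /eqP WB; have := Wt k; rewrite WB; case: ltnP => //; lia.
  - rewrite /T1; elim/big_ind: _ => [|a b ta tb|k WB]; first by rewrite subn0.
      by case: (leqP a b).
    have := Wt k; have := ltn_ord t; case: (ltnP t (theta k)) => [|_ _]; first by lia.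
    by rewrite addn0 (negbTE WB).
  have := Wg k; case: (eqVneq (W k) (B k)) => [WB _|WB /= /eqP ->].
    by rewrite WB ltnNge (leq_trans (leq_bigmax_cond k _) T0t) ?WB ?addn0.
  by rewrite (leq_trans tT1 (T1_le k WB)) addn1.
under eq_bigl do rewrite PE.
have [T01|T10] := leqP T0 T1; last first.
  rewrite [RHS]big_pred0 => [|t]; last by apply/negbTE; lia.
  by apply/max_idPl; have := M_le (ltnW T10); lra.
have -> : M T1 = M T0 + \sum_(t < m.+1 | (T0 <= t < T1)%N) mu t.
  rewrite /M (bigID (fun t : 'I_m.+1 => (t < T0)%N)) /=; congr (_ + _).
    by apply: eq_bigl => t; lia.
  by apply: eq_bigl => t; lia.
rewrite (_ : 1 - _ + _ = \sum_(t < m.+1 | (T0 <= t < T1)%N) mu t); last by lra.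
by apply/max_idPr; exact: sumr_ge0.
Qed.

End Hat.

(** * Global coordinates on the polyhedron *)

Section Coordinates.
Variables (R : realType) (N m p q : nat).
Variables (V : 'I_p -> 'rV[R]_N) (top : 'I_q -> 'I_m.+1 -> 'I_p).
Hypothesis cplx : simplicial_complex V top.
Local Notation vtx i := (fun j => V (top i j)).

Let top_lt i (j k : 'I_m.+1) : (j < k)%N -> (top i j < top i k)%N.
Proof. by case: cplx => + _; apply. Qed.

Let vtx_free i : row_free (edge_mx (vtx i)).
Proof. by case: cplx => _ [_ [+ _]]; apply. Qed.

Lemma top_inj i : injective (top i).
Proof.
move=> j k jk; apply/val_inj/eqP => /=.
case: ltngtP => // /(top_lt i); by rewrite jk ltnn.
Qed.

Definition chart i (z : 'rV[R]_N) : 'rV[R]_m :=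
  (z - V (top i ord0)) *m pinvmx (edge_mx (vtx i)).

Lemma phiK i : cancel (phi (vtx i)) (chart i).
Proof. by move=> t; rewrite /chart /phi addrAC subrr add0r mulmxKp. Qed.

Definition weight i (t : 'rV[R]_m) (k : 'I_p) : R :=
  \sum_(j | top i j == k) bary t j.

(* Coordinates of [phi (vtx i) t] in the standard simplex on all the vertices *)
(* of K, rearranged by partial sums as in the definition of [iota].           *)
Definition cumul i (t : 'rV[R]_m) (k : 'I_p) : R :=
  \sum_(j | (top i j <= k)%N) bary t j.

Lemma cumul_weight i t k : cumul i t k = \sum_(k' < p | (k' <= k)%N) weight i t k'.
Proof.
rewrite /cumul (partition_big (top i) (fun k' : 'I_p => (k' <= k)%N)) //=.
apply: eq_bigr => k' k'k; apply: eq_bigl => j.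
by case: eqP => [->|]; rewrite ?k'k ?andbF.
Qed.

Lemma weight_notin i t k : k \notin top_set top i -> weight i t k = 0.
Proof.
move=> kN; apply: big_pred0 => j; apply: contraNF kN => /eqP <-.
exact: imset_f.
Qed.

Lemma weight_top i t j : weight i t (top i j) = bary t j.
Proof. by apply: big_pred1 => j'; rewrite (inj_eq (@top_inj i)). Qed.

Lemma phi_weight i t : phi (vtx i) t = \sum_k weight i t k *: V k.
Proof.
rewrite phi_bary (partition_big (top i) xpredT) //=; apply: eq_bigr => k _.
by rewrite scaler_suml; apply: eq_bigr => j /eqP ->.
Qed.

Lemma phi_conv i t : std_simplex t -> conv_idx V (top_set top i) (phi (vtx i) t).
Proof.
move=> ts; exists (weight i t); split=> [k|]; first by apply: sumr_ge0 => j _; exact: bary_ge0.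
split; first exact: weight_notin.
by split; [rewrite -(sum_bary t) [RHS](partition_big (top i) xpredT)|exact: phi_weight].
Qed.

(** Affine independence of the vertices: [lam] defines a point [t'] with the same image under [phi]
    as [t], and [chart] inverts [phi]. *)
Lemma weight_unique i t (lam : 'I_p -> R) :
  (forall k, k \notin top_set top i -> lam k = 0) -> \sum_k lam k = 1 ->
  phi (vtx i) t = \sum_k lam k *: V k -> lam =1 weight i t.
Proof.
move=> lam0 lam1 tlam.
have sum_top (U : lmodType R) (F : 'I_p -> U) :
    \sum_k lam k *: F k = \sum_j lam (top i j) *: F (top i j).
  rewrite (bigID (mem (top_set top i))) /= [X in _ + X]big1 ?addr0 => [|k /lam0 ->].
    by rewrite big_imset //= => j k _ _; exact: top_inj.
  by rewrite scale0r.
pose t' : 'rV[R]_m := \row_j lam (top i (lift ord0 j)).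
have bt' j : bary t' j = lam (top i j).
  case: (unliftP ord0 j) => [k|] ->; first by rewrite baryS mxE.
  have := sum_top R^o (fun=> 1).
  under eq_bigr do rewrite [_ *: _]mulr1; under [RHS]eq_bigr do rewrite [_ *: _]mulr1.
  rewrite lam1 big_ord_recl bary0 => ->.
  by under [X in _ - X = _]eq_bigr do rewrite mxE; rewrite addrK.
have tt' : t = t'.
  rewrite -[LHS](phiK i) -[RHS](phiK i); congr (chart i _).
  by rewrite tlam phi_bary sum_top; apply: eq_bigr => j _; rewrite bt'.
move=> k; have [/imsetP[j _ ->]|kN] := boolP (k \in top_set top i).
  by rewrite weight_top tt' bt'.
by rewrite lam0 // weight_notin.
Qed.

(** A common point is a convex combination of the vertices of a common face, and uniqueness of
    weights in either simplex identifies both weight functions with this one. This replaces all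
    gluing. *)
Lemma cumul_overlap i i' t t' : std_simplex t -> std_simplex t' ->
  phi (vtx i) t = phi (vtx i') t' -> cumul i t =1 cumul i' t'.
Proof.
move=> ts ts' tt' k; rewrite !cumul_weight; apply: eq_bigr => k' _.
have top0 i0 : (0 < #|top_set top i0|)%N.
  by apply/card_gt0P; exists (top i0 ord0); exact: imset_f.
case: cplx => _ [_ [_ /(_ i i' _ _ (top0 i) (subxx _) (top0 i') (subxx _))]].
move=> [F [Fi [Fi' FE]]].
have : conv_idx V F (phi (vtx i) t).
  by rewrite -FE; split; [exact: phi_conv|rewrite tt'; exact: phi_conv].
case=> lam [_ [lam0 [lam1 lamE]]].
rewrite -(@weight_unique i t lam) // => [|k1 k1N]; last first.
  by apply: lam0; apply: contraNN k1N; exact: (fintype.subsetP Fi).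
rewrite -(@weight_unique i' t' lam) // => [k1 k1N|]; last by rewrite -tt'.
by apply: lam0; apply: contraNN k1N; exact: (fintype.subsetP Fi').
Qed.

(** As [top i] is increasing, this counts the vertices of the simplex up to [k], so that [cumul] at
    [k] is the sum of the first [idx i k] barycentric coordinates. *)
Definition idx i (k : 'I_p) : nat := \max_(j < m.+1 | (top i j <= k)%N) j.+1.

Lemma idx_le i k : (idx i k <= m.+1)%N.
Proof. by apply/bigmax_leqP => j _; exact: ltn_ord. Qed.

Lemma top_leE i (j : 'I_m.+1) (k : 'I_p) : (top i j <= k)%N = (j < idx i k)%N.
Proof.
apply/idP/idP => [|jk].
  exact: (@leq_bigmax_cond _ (fun j => top i j <= k)%N (fun j : 'I_m.+1 => j.+1)).
rewrite leqNgt; apply: contraTN jk => kj; rewrite -leqNgt.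
apply/bigmax_leqP => j' j'k; rewrite ltnNge; apply: contraTN kj => jj'.
rewrite -leqNgt (leq_trans _ j'k) //.
by move: jj'; rewrite leq_eqVlt => /predU1P[/val_inj ->|/(top_lt i)/ltnW].
Qed.

Lemma idx_top i (j : 'I_m.+1) : idx i (top i j) = j.+1.
Proof.
apply/eqP; rewrite eqn_leq -top_leE leqnn andbT.
apply/bigmax_leqP => j'; rewrite ltnNge; apply: contraTN => /(top_lt i).
by rewrite -ltnNge.
Qed.

Lemma sum_bary_tcoord (x : 'rV[R]_m) s : (s <= m.+1)%N ->
  \sum_(j < m.+1 | (j < s)%N) bary (tcoord x) j = node x s.
Proof.
move=> sm; under eq_bigr do rewrite bary_tcoord.
rewrite -(big_ord_widen _ (fun j => node x j.+1 - node x j)) //.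
by rewrite -(big_mkord xpredT (fun j => node x j.+1 - node x j)) telescope_sumr ?subr0.
Qed.

Lemma cumul_tcoord i (x : 'rV[R]_m) k : cumul i (tcoord x) k = node x (idx i k).
Proof.
by rewrite -sum_bary_tcoord ?idx_le //; apply: eq_bigl => j; rewrite top_leE.
Qed.

Let pred_ord (k : 'I_p) : 'I_p := Ordinal (leq_ltn_trans (leq_pred k) (ltn_ord k)).

(** Differences of partial sums give the weights back. No simplex is mentioned, so a map sampled
    through [of_cumul] has one value per lattice point. *)
Definition of_cumul (X : 'I_p -> R) : 'rV[R]_N :=
  \sum_k (X k - (if (k : nat) is 0 then 0 else X (pred_ord k))) *: V k.

Lemma of_cumulE i t : of_cumul (cumul i t) = phi (vtx i) t.
Proof.
rewrite phi_weight; apply: eq_bigr => k _; congr (_ *: _).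
rewrite (cumul_weight _ _ k) (bigD1 k) //= -addrA.
case kE : (k : nat) => [|k'].
  rewrite subr0 big_pred0 ?addr0 // => k1; apply/negbTE.
  by rewrite -val_eqE /= kE leqn0 andbN.
rewrite cumul_weight [X in _ + (X - _)](_ : _ =
  \sum_(k1 < p | (k1 <= pred_ord k)%N) weight i t k1).
  by rewrite subrr addr0.
by apply: eq_bigl => k1; rewrite -val_eqE /= kE /=; lia.
Qed.

End Coordinates.

(** * Piecewise linear maps on the crystalline subdivision *)

(** Summation by parts; it turns a convex combination of the values along a chain into a base value
    plus a linear term in the differences. *)
Lemma abel_sum (R : pzRingType) (U : lmodType R) (g : nat -> R) (f : nat -> U) m :
  \sum_(t < m.+1) (g t.+1 - g t) *: f t =
  g m.+1 *: f m - g 0%N *: f 0%N + \sum_(s < m) g s.+1 *: (f s - f s.+1).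
Proof.
elim: m => [|m IHm]; first by rewrite big_ord0 addr0 big_ord1 scalerBl.
rewrite big_ord_recr IHm /= [in RHS]big_ord_recr /= scalerBl scalerBr.
set S := \sum_(_ < _) _; set a := g m.+1 *: f m; set b := g m.+2 *: _.
set c := g m.+1 *: f m.+1; set d := g 0%N *: _.
by rewrite [LHS](AC (3*2) ((4*2)*(3*(1*5)))).
Qed.

Notation lattice p l := {ffun 'I_p -> 'I_(2 ^ l).+1}.

Section Interpolation.
Variables (R : realType) (N m n p q : nat).
Variables (V : 'I_p -> 'rV[R]_N) (top : 'I_q -> 'I_m.+1 -> 'I_p).
Hypothesis cplx : simplicial_complex V top.
Local Notation vtx i := (fun j => V (top i j)).

Definition pl_interp l (h : lattice p l -> 'rV[R]_n) (X : 'I_p -> R) : 'rV[R]_n :=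
  \sum_(W : lattice p l) hat (fun k => 2 ^+ l * X k - (W k : nat)%:R) *: h W.

Definition pl_map l (h : lattice p l -> 'rV[R]_n) (z : 'rV[R]_N) : 'rV[R]_n :=
  if [pick i | `[< simplex_set (vtx i) z >]] is Some i
  then pl_interp h (cumul top i (chart V top i z)) else 0.

(** [pick] may return another top simplex containing the point; by [cumul_overlap] this gives the
    same value. *)
Lemma pl_mapE l (h : lattice p l -> 'rV[R]_n) i t : std_simplex t ->
  pl_map h (phi (vtx i) t) = pl_interp h (cumul top i t).
Proof.
move=> ts; rewrite /pl_map; case: pickP => [i' /asboolP[t' ts' tt']|/(_ i)]; last first.
  by move/asboolP; case; exists t.
by rewrite -tt' phiK //; congr pl_interp; apply/funext; exact: cumul_overlap tt'.
Qed.

Variables (l : nat) (c : 'I_m -> 'I_(2 ^ l)) (pi : {perm 'I_m}).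

Definition rank (a : 'I_m) : nat := (pi^-1)%g a.

(** At [t = 0] all coordinates of the cube corner are raised by one; passing from [t] to [t.+1]
    lowers the one of rank [t]. The end nodes have bound 0 in the comparison, so they are never
    raised. *)
Definition crystal_vertex (i : 'I_q) (t : nat) : lattice p l :=
  [ffun k => inord (bnode 0 (2 ^ l) (fun a => c a) (idx top i k) +
                    (t < bnode 0 0 (fun a => (rank a).+1) (idx top i k)))%N].

Definition crystal_diff (i : 'I_q) (h : lattice p l -> 'rV[R]_n) : 'M[R]_(m, n) :=
  \matrix_a (h (crystal_vertex i (rank a)) - h (crystal_vertex i (rank a).+1)).

Lemma crystal_vertexE i t k : (crystal_vertex i t k : nat) =
  (bnode 0 (2 ^ l) (fun a => c a) (idx top i k) +
   (t < bnode 0 0 (fun a => (rank a).+1) (idx top i k)))%N.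
Proof.
rewrite ffunE inordK //; case: (bnode_cases (idx_le top i k)) => [->|[a ->]|->].
- by [].
- by rewrite !bnodeS ltnS; have := ltn_ord (c a); case: (t < _)%N; lia.
- by rewrite !bnode_last addn0.
Qed.

Lemma crystal_vertex_top i t a :
  (crystal_vertex i t (top i (widen_ord (leqnSn m) a)) : nat) = (c a + (t <= rank a))%N.
Proof. by rewrite crystal_vertexE (idx_top cplx) !bnodeS. Qed.

Definition cube_point (y : 'rV[R]_m) : 'rV[R]_m :=
  (2 ^+ l)^-1 *: (\row_a ((c a : nat)%:R) + y).

Definition kuhn (y : 'rV[R]_m) : Prop :=
  (forall a, 0 <= y 0 a <= 1) /\
  (forall a b : 'I_m, (a <= b)%N -> y 0 (pi a) <= y 0 (pi b)).

Definition kuhn_weight (y : 'rV[R]_m) (t : 'I_m.+1) : R :=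
  bary (tcoord (\row_a y 0 (pi a))) t.

Lemma kuhn_iota y : kuhn y -> iota_simplex (\row_a y 0 (pi a)).
Proof. by case=> y01 yle; split=> [a|a b ab]; rewrite !mxE ?yle. Qed.

Lemma kuhn_weight_ge0 y t : kuhn y -> 0 <= kuhn_weight y t.
Proof. by move=> yk; apply: bary_ge0; apply: tcoord_std; exact: kuhn_iota. Qed.

(** By [hat_chain] the hat at [W] is the total weight of the chain positions equal to [W];
    exchanging the sums leaves one term per position. *)
Lemma pl_interp_crystal i (h : lattice p l -> 'rV[R]_n) y : kuhn y ->
  pl_interp h (cumul top i (tcoord (cube_point y))) =
  \sum_(t < m.+1) kuhn_weight y t *: h (crystal_vertex i t).
Proof.
move=> yk; pose mu := kuhn_weight y.
have hatE (W : lattice p l) :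
    hat (fun k => 2 ^+ l * cumul top i (tcoord (cube_point y)) k - (W k : nat)%:R) =
    \sum_(t < m.+1 | W == crystal_vertex i t) mu t.
  transitivity (\sum_(t < m.+1 | [forall k, (W k : nat) ==
      (bnode 0 (2 ^ l) (fun a => c a) (idx top i k) +
       (t < bnode 0 0 (fun a => (rank a).+1) (idx top i k)))%N]) mu t); last first.
    apply: eq_bigl => t; apply/forallP/eqP => [Wt|-> k]; last by rewrite crystal_vertexE.
    by apply/ffunP => k; apply/val_inj => /=; rewrite crystal_vertexE; exact/eqP.
  rewrite -(@hat_chain R p m mu _ (fun k => W k) _); first last.
  - exact: sum_bary.
  - by move=> t; exact: kuhn_weight_ge0.
  congr hat; apply/funext => k; congr (_ - _); rewrite (cumul_tcoord cplx).
  have l0 : 2 ^+ l != 0 :> R by rewrite expf_neq0 // pnatr_eq0.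
  case: (bnode_cases (idx_le top i k)) => [->|[a ->]|->].
  - by rewrite big_pred0 // mulr0 addr0.
  - rewrite nodeS !bnodeS !mxE mulrA mulfV // mul1r; congr (_ + _).
    rewrite sum_bary_tcoord ?ltnS 1?ltnW ?ltn_ord // nodeS mxE.
    by rewrite permKV.
  - by rewrite node_last !bnode_last mulr1 big_pred0 // addr0 natrX.
rewrite /pl_interp; under eq_bigr do rewrite hatE scaler_suml.
rewrite (exchange_big_dep xpredT) //=; apply: eq_bigr => t _.
by rewrite big_pred1_eq.
Qed.

Lemma pl_interp_affine i (h : lattice p l -> 'rV[R]_n) y : kuhn y ->
  pl_interp h (cumul top i (tcoord (cube_point y))) =
  h (crystal_vertex i m) + y *m crystal_diff i h.
Proof.
move=> yk; rewrite pl_interp_crystal //.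
under eq_bigr do rewrite /kuhn_weight bary_tcoord.
rewrite (abel_sum _ (fun t => h (crystal_vertex i t))) node_last scale1r.
rewrite scale0r subr0; congr (_ + _).
rewrite mulmx_sum_row [RHS](reindex_inj (@perm_inj _ pi)) /=; apply: eq_bigr => s _.
by rewrite nodeS mxE rowK /rank permK.
Qed.

(** The rows of [crystal_diff], scaled by [2 ^+ l], are the difference quotients along the cube
    axes; [- lower_mx] converts them to the coordinates of [phi], as in [tcoordK]. *)
Definition crystal_slope (i : 'I_q) (h : lattice p l -> 'rV[R]_n) : 'M[R]_(m, n) :=
  - (lower_mx R m *m (2 ^+ l *: crystal_diff i h)).

Lemma pl_map_affine i (h : lattice p l -> 'rV[R]_n) :
  @cube_simplex R m l c pi `<=` @iota_simplex R m ->
  exists b, forall x, @cube_simplex R m l c pi x ->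
    pl_map h (phi (vtx i) (tcoord x)) = tcoord x *m crystal_slope i h + b.
Proof.
move=> adm.
exists (h (crystal_vertex i m) + const_mx 1 *m (2 ^+ l *: crystal_diff i h)
  - \row_a ((c a : nat)%:R) *m crystal_diff i h) => x xc.
rewrite pl_mapE; last by apply: tcoord_std; exact: adm.
case: xc => y [y01 [yle xE]].
have -> : x = cube_point y by [].
rewrite pl_interp_affine //.
have {1}-> : y = 2 ^+ l *: cube_point y - \row_a ((c a : nat)%:R).
  rewrite scalerA mulfV ?scale1r; first by rewrite addrAC subrr add0r.
  by rewrite expf_neq0 // pnatr_eq0.
have xE' : (2 ^+ l *: cube_point y) *m crystal_diff i h =
    tcoord (cube_point y) *m crystal_slope i h +
    const_mx 1 *m (2 ^+ l *: crystal_diff i h).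
  rewrite /crystal_slope mulmxN mulmxA addrC -mulmxBl tcoordK.
  by rewrite -scalemxAr -scalemxAl.
rewrite mulmxBl xE' !addrA; congr (_ - _).
by rewrite (addrC (h _)).
Qed.

Lemma pl_map_convex i (h : lattice p l -> 'rV[R]_n) x :
  @cube_simplex R m l c pi `<=` @iota_simplex R m -> @cube_simplex R m l c pi x ->
  exists mu : 'I_m.+1 -> R, [/\ forall t, 0 <= mu t, \sum_t mu t = 1 &
    pl_map h (phi (vtx i) (tcoord x)) = \sum_t mu t *: h (crystal_vertex i t)].
Proof.
move=> adm /[dup] xc [y [y01 [yle ->]]]; exists (kuhn_weight y); split.
- by move=> t; exact: kuhn_weight_ge0.
- exact: sum_bary.
- rewrite pl_mapE ?pl_interp_crystal //; apply: tcoord_std; apply: adm.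
  by exists y.
Qed.

Definition corner (t : nat) : 'rV[R]_m := cube_point (\row_a (t <= rank a)%:R).

Lemma corner_kuhn t : kuhn (\row_a (t <= rank a)%:R).
Proof.
split=> [a|a b ab]; rewrite !mxE; first by case: leqP; rewrite !lexx ler01.
by rewrite /rank !permK ler_nat; case: (leqP t a) => // ta; rewrite (leq_trans ta ab).
Qed.

Lemma corner_cube t : @cube_simplex R m l c pi (corner t).
Proof. by case: (corner_kuhn t) => ? ?; exists (\row_a (t <= rank a)%:R). Qed.

(** Identifies lattice vertices with geometric corners, so that sampling at the former reads the map
    at the latter. *)
Lemma crystal_vertex_cumul i t k :
  (crystal_vertex i t k : nat)%:R = 2 ^+ l * cumul top i (tcoord (corner t)) k :> R.
Proof.
rewrite crystal_vertexE (cumul_tcoord cplx).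
have l0 : 2 ^+ l != 0 :> R by rewrite expf_neq0 // pnatr_eq0.
case: (bnode_cases (idx_le top i k)) => [->|[a ->]|->].
- by rewrite mulr0.
- by rewrite nodeS !bnodeS !mxE mulrA mulfV // mul1r ltnS natrD.
- by rewrite !bnode_last node_last mulr1 addn0 natrX.
Qed.

End Interpolation.

(** * Perturbation of the vertex values *)

Section MatrixNorm.
Variable R : realType.

Lemma coord_le_norm a b (A : 'M[R]_(a, b)) i j : `|A i j| <= `|A|.
Proof.
rewrite [leRHS]/Num.Def.normr /= mx_normrE.
exact: (le_bigmax _ (fun ij => `|A ij.1 ij.2|) (i, j)).
Qed.

Lemma mx_norm_le a b (A : 'M[R]_(a, b)) e :
  0 <= e -> (forall i j, `|A i j| <= e) -> `|A| <= e.
Proof.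
move=> e0 Ae; rewrite [leLHS]/Num.Def.normr /= mx_normrE.
by apply: bigmax_le => // -[i j] _; exact: Ae.
Qed.

Lemma natr_mul_sum b (x : R) : b%:R * x = \sum_(j < b) x.
Proof. by rewrite sumr_const card_ord mulr_natl. Qed.

Lemma mulmx_norm_le a b c (A : 'M[R]_(a, b)) (B : 'M[R]_(b, c)) :
  `|A *m B| <= b%:R * `|A| * `|B|.
Proof.
apply: mx_norm_le => [|i k]; first by rewrite !mulr_ge0.
rewrite mxE (le_trans (ler_norm_sum _ _ _)) //.
rewrite -mulrA natr_mul_sum.
by apply: ler_sum => j _; rewrite normrM ler_pM ?coord_le_norm.
Qed.

(** A crude constant suffices; the successor keeps it positive for empty matrices, so that one can
    divide by it. *)
Lemma eucl_le a b (A : 'M[R]_(a, b)) : eucl A <= (a * b).+1%:R * `|A|.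
Proof.
have -> : (a * b).+1%:R * `|A| = Num.sqrt (((a * b).+1%:R * `|A|) ^+ 2).
  by rewrite sqrtr_sqr ger0_norm // mulr_ge0.
rewrite ler_wsqrtr // (@le_trans _ _ ((a * b)%:R * `|A| ^+ 2)) //.
  rewrite natrM -mulrA natr_mul_sum.
  apply: ler_sum => i _; rewrite natr_mul_sum.
  by apply: ler_sum => j _; rewrite -real_normK ?num_real // lerXn2r ?nnegrE ?coord_le_norm.
rewrite exprMn ler_wpM2r ?exprn_ge0 // -natrX ler_nat.
by rewrite (leq_trans (leqnSn _)) // -[leqLHS]muln1 leq_mul.
Qed.

Lemma lower_mx_unit m : lower_mx R m \in unitmx.
Proof.
rewrite unitmxE det_trig.
  by rewrite big1 ?unitr1 // => i _; rewrite mxE leqnn.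
by apply/is_trig_mxP => i j ij; rewrite mxE leqNgt ij.
Qed.

End MatrixNorm.

Section Perturbation.
(** In the application [a] is the level of subdivision, [S a] its admissible simplices, [W a] its
    lattice points and [L] the change of slope caused by a change of vertex values. [K] and the
    radii in [porous] are uniform in [a]. *)
Variables (R : realType) (U Z : normedModType R) (C : eqType).
Variables (I : Type) (S W : I -> Type).
Variables (colour : forall a, S a -> C) (L : forall a, S a -> (W a -> U) -> Z).
Variables (A0 : forall a, S a -> Z) (good : forall a, S a -> R -> Z -> Prop) (K : R).
Hypothesis K_gt0 : 0 < K.
Hypothesis L_add : forall a (x : S a) w w',
  L x (fun i => w i + w' i) = L x w + L x w'.
Hypothesis L_bound : forall a (x : S a) w e, 0 <= e ->
  (forall i, `|w i| <= e) -> `|L x w| <= K * e.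
Hypothesis L_solve : forall a (k : C) (B : S a -> Z) e, 0 <= e ->
  (forall x, `|B x| <= e) -> exists w : W a -> U,
    (forall i, `|w i| <= K * e) /\ forall x, colour x = k -> L x w = B x.
Hypothesis good_half : forall a (x : S a) r A A',
  good x r A -> `|A' - A| <= r / 2 -> good x (r / 2) A'.
Hypothesis good_le : forall a (x : S a) r r' A, r' <= r -> good x r A -> good x r' A.
Hypothesis porous : forall e, 0 < e -> exists2 r, 0 < r &
  forall a (x : S a) A, `|A - A0 x| <= 1 -> exists2 A', `|A' - A| <= e & good x r A'.

(* The colours are treated one after the other; each step is so small that it *)
(* does not spoil the radii of goodness obtained in the previous ones.        *)
Lemma perturb_colours (s : seq C) e : 0 < e -> K * e <= 1 ->
  exists2 r, 0 < r & forall a, exists w : W a -> U,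
    (forall i, `|w i| <= e) /\
    forall x : S a, colour x \in s -> good x r (A0 x + L x w).
Proof.
elim: s e => [|k s IHs] e e0 Ke.
  by exists 1 => // a; exists (fun=> 0); split=> // i; rewrite normr0 ltW.
have [||r1 r10 IH] := IHs (e / 2); first by rewrite divr_gt0.
  by rewrite mulrA; move: Ke (mulr_gt0 K_gt0 e0); lra.
(* The first bound makes the new correction, of size [K * d], fit into the remaining [e / 2]. The
   second limits its effect on the slopes treated before to half of their radius [r1]. *)
pose d := Num.min (e / 2 / K) (r1 / 2 / K / K).
have d0 : 0 < d by rewrite lt_min !divr_gt0.
have dK : K * d <= e / 2 by rewrite mulrC -ler_pdivlMr // ge_min lexx.
have dKK : K * (K * d) <= r1 / 2.
  by rewrite mulrC -ler_pdivlMr // mulrC -ler_pdivlMr // ge_min lexx orbT.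
have [r2 r20 por] := porous d0.
exists (Num.min (r1 / 2) r2); first by rewrite lt_min r20 divr_gt0.
move=> a; have [w1 [w1e w1g]] := IH a.
have e20 : 0 <= e / 2 by rewrite divr_ge0 // ltW.
have LA x : `|A0 x + L x w1 - A0 x| <= 1.
  rewrite [X in `|X|]addrAC subrr add0r (le_trans (L_bound x e20 w1e)) //.
  by rewrite mulrA; move: Ke (mulr_gt0 K_gt0 e0); lra.
have /choice[A' A'P] x : exists A', `|A' - (A0 x + L x w1)| <= d /\ good x r2 A'.
  by have [A' ? ?] := por a x _ (LA x); exists A'.
have [w2 [w2d w2k]] := L_solve k (ltW d0) (fun x => (A'P x).1).
exists (fun i => w1 i + w2 i); split=> [i|x].
  by rewrite (le_trans (ler_normD _ _)) // [e]splitr lerD // (le_trans (w2d i)).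
rewrite inE L_add addrA; case: eqP => [xk _|_ /= xs].
  rewrite w2k // addrC subrK; apply: good_le (A'P x).2.
  by rewrite ge_min lexx orbT.
apply: (@good_le _ _ (r1 / 2)); first by rewrite ge_min lexx.
apply: good_half (w1g x xs) _; rewrite [X in `|X|]addrAC subrr add0r.
by apply: le_trans dKK; apply: L_bound => //; rewrite mulr_ge0 ?ltW.
Qed.

End Perturbation.

(** * Independent prescription of slopes within one class of simplices *)

Section CrystalColours.
Variables (R : realType) (N m n p q : nat).
Variables (V : 'I_p -> 'rV[R]_N) (top : 'I_q -> 'I_m.+1 -> 'I_p).
Hypothesis cplx : simplicial_complex V top.
Variables (l : nat) (i : 'I_q) (pi : {perm 'I_m}) (par : {ffun 'I_m -> bool}).
Implicit Type c : 'I_m -> 'I_(2 ^ l).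

Definition parity c : {ffun 'I_m -> bool} := [ffun a => odd (c a)].

(* Two simplices of the same top simplex of K with the same permutation and   *)
(* the same parity have no vertex in common.                                  *)
Lemma crystal_vertex_inj c c' t t' : parity c = parity c' ->
  crystal_vertex top c pi i t = crystal_vertex top c' pi i t' ->
  c = c' /\ forall a, (t <= rank pi a)%N = (t' <= rank pi a)%N.
Proof.
move=> cc' vv'.
have key a : c a = c' a :> nat /\ (t <= rank pi a)%N = (t' <= rank pi a)%N.
  have := crystal_vertex_top cplx c pi i t a.
  rewrite vv' (crystal_vertex_top cplx).
  move/ffunP : cc' => /(_ a); rewrite !ffunE.
  by case: leqP => _; case: leqP => _ /=; lia.
by split=> [|a]; [apply/funext => a; apply/val_inj; case: (key a)|case: (key a)].
Qed.

(** Vertex [t] of a simplex receives the sum of the prescribed rows of rank at least [t], so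
    consecutive differences return single rows. By [crystal_vertex_inj] no vertex receives two
    values; lattice points outside the class get 0. *)
Lemma crystal_diff_solve (B : ('I_m -> 'I_(2 ^ l)) -> 'M[R]_(m, n)) e : 0 <= e ->
  (forall c, `|B c| <= e) -> exists w : lattice p l -> 'rV[R]_n,
    (forall W, `|w W| <= m%:R * e) /\
    forall c, parity c = par -> crystal_diff top c pi i w = B c.
Proof.
move=> e0 Be.
pose ind t : 'rV[R]_m := \row_a (t <= rank pi a)%:R.
pose Q W (ct : ('I_m -> 'I_(2 ^ l)) * nat) :=
  parity ct.1 = par /\ W = crystal_vertex top ct.1 pi i ct.2.
pose w W := if pselect (exists ct, Q W ct) is left e
  then ind (sval (cid e)).2 *m B (sval (cid e)).1 else 0.
have wE c t : parity c = par ->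
    w (crystal_vertex top c pi i t) = ind t *m B c.
  move=> cp; rewrite /w; case: pselect => [ex|]; last by case; exists (c, t).
  case: cid => -[c' t'] /= [c'p vv'].
  have [-> tt'] := crystal_vertex_inj (etrans cp (esym c'p)) vv'.
  by congr (_ *m _); apply/rowP => a; rewrite !mxE tt'.
exists w; split=> [W|c cp].
  rewrite /w; case: pselect => [ex|_]; last by rewrite normr0 mulr_ge0.
  rewrite (le_trans (mulmx_norm_le _ _)) // -mulrA ler_wpM2l //.
  rewrite -[leRHS]mul1r ler_pM //; apply: mx_norm_le => // k a; rewrite mxE.
  by case: (_ <= _)%N; rewrite ?normr0 ?normr1.
apply/row_matrixP => a; rewrite rowK !wE // -mulmxBl rowE; congr (_ *m _).
apply/rowP => b; rewrite !mxE eqxx /=.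
have -> : (b == a) = (rank pi a == rank pi b).
  by rewrite /rank (inj_eq val_inj) (inj_eq perm_inj) eq_sym.
by case: ltngtP => _; rewrite ?subrr ?subr0.
Qed.

End CrystalColours.

(** * Smooth maps on a simplex *)

Section Analysis.
Variable R : realType.

Lemma mx_continuous (T : topologicalType) a b (f : T -> 'M[R]_(a, b)) x :
  (forall i j, {for x, continuous (fun y => f y i j)}) -> {for x, continuous f}.
Proof.
move=> fc; apply/cvgrPdist_le => e e0.
suff : \forall y \near x, forall ij : 'I_a * 'I_b, `|f x ij.1 ij.2 - f y ij.1 ij.2| <= e.
  apply: filterS => y fxy; apply: mx_norm_le => [|i j]; first exact: ltW.
  by rewrite !mxE; exact: (fxy (i, j)).
by apply: filter_forall => -[i' j']; have /cvgrPdist_le /(_ e e0) := fc i' j'.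
Qed.

Lemma mulmxr_continuous a b c (B : 'M[R]_(b, c)) :
  continuous (fun A : 'M[R]_(a, b) => A *m B).
Proof.
move=> A; apply: mx_continuous => i j.
rewrite (_ : (fun _ => _) = fun y : 'M[R]_(a, b) => \sum_k y i k * B k j); last first.
  by apply/funext => y; rewrite mxE.
apply: (@continuous_big _ _ +%R 0 xpredT) => [|k _ y]; first exact: add_continuous.
by apply: continuousM; [exact: coord_continuous|exact: cst_continuous].
Qed.

Lemma phi_continuous N m (v : 'I_m.+1 -> 'rV[R]_N) : continuous (phi v).
Proof.
move=> t.
apply: (@continuousD R _ 'rV[R]_m (cst (v ord0)) (fun t : 'rV[R]_m => t *m edge_mx v) t).
  exact: cst_continuous.
exact: mulmxr_continuous. Qed.

(** The near-covering form of compactness, along the filter of positive reals tending to 0, makes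
    the local thresholds uniform. *)
Lemma compact_near_pos (T : topologicalType) (A : set T) (P : R -> T -> Prop) :
  compact A ->
  (forall x, A x -> exists2 e, 0 < e & \forall y \near x, forall d, 0 < d < e -> P d y) ->
  exists2 d, 0 < d & forall x, A x -> P d x.
Proof.
move=> /compact_near_coveringP cA AP.
suff : \forall d \near (0 : R)^'+, A `<=` P d.
  by move=> AP'; near (0 : R)^'+ => d; exists d; [|exact: (near AP' d)].
apply: cA => x /AP[e e0 xe].
exists ([set y | forall d, 0 < d < e -> P d y], [set d | 0 < d < e]); last first.
  by move=> [y d] /= [/(_ d)].
split=> //=; near=> d; apply/andP; split.
  by near: d; exact: nbhs_right_gt.
by near: d; exact: nbhs_right_lt.
Unshelve. all: by end_near. Qed.

(** Continuity at the points of [A] is meant in the whole space, which is why only one of the two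
    points has to lie in [A]. *)
Lemma compact_unif_continuous (U W : normedModType R) (A : set U) (f : U -> W) :
  compact A -> (forall x, A x -> {for x, continuous f}) ->
  forall e, 0 < e -> exists2 d, 0 < d &
    forall x y, A x -> `|x - y| < d -> `|f x - f y| < e.
Proof.
move=> cA fc e e0.
have [x Ax|d d0 Ad] := @compact_near_pos _ A
    (fun d x => forall y, `|x - y| < d -> `|f x - f y| < e) cA; last first.
  by exists d => // x y /Ad; apply.
have /cvgrPdist_lt /(_ (e / 2)) := fc x Ax; rewrite divr_gt0 // => /(_ isT).
move=> /nbhs_normP[/= d d0 xd].
exists (d / 2); first by rewrite divr_gt0.
apply/nbhs_normP; exists (d / 2); first by rewrite /= divr_gt0.
move=> y /= xy d' /andP[_ d'd] z yz.
have fy : `|f x - f y| < e / 2 by apply: xd => /=; apply: lt_trans xy _; lra.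
have fz : `|f x - f z| < e / 2.
  apply: xd => /=; rewrite -(subrKA y) (le_lt_trans (ler_normD _ _)) //.
  by rewrite [d]splitr ltrD // (lt_trans yz).
rewrite -(subrKA (f x)) (le_lt_trans (ler_normD _ _)) // [e]splitr ltrD //.
by rewrite distrC.
Qed.

Lemma std_simplex_compact m : compact (@std_simplex R m).
Proof.
apply: bounded_closed_compact.
  exists 1; split=> // b b1 t [t0 t1].
  apply: mx_norm_le => [|i j]; first by rewrite ltW // (lt_trans ltr01).
  rewrite (ord1 i) ger0_norm // (le_trans _ (ltW b1)) // (le_trans _ t1) //.
  by rewrite (bigD1 j) //= lerDl sumr_ge0.
have -> : @std_simplex R m =
    \bigcap_(j in [set: 'I_m]) ((fun t : 'rV[R]_m => t 0 j) @^-1` [set x | 0 <= x]) `&`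
    (fun t : 'rV[R]_m => \sum_j t 0 j) @^-1` [set x | x <= 1].
  apply/seteqP; split=> t [t0 t1]; split=> //= j; first by move=> _; exact: t0.
  exact: t0.
apply: closedI; first apply: closed_bigI => j _.
  by apply: preimage_closed (@closed_ge _ _) => t _; exact: coord_continuous.
apply: preimage_closed (@closed_le _ _) => t _.
apply: (@continuous_big _ _ +%R 0 xpredT) => [|k _]; first exact: add_continuous.
exact: coord_continuous.
Qed.

Lemma mx_ball_compact a b (r : R) : compact [set A : 'M[R]_(a, b) | `|A| <= r].
Proof.
have -> : [set A : 'M[R]_(a, b) | `|A| <= r] =
    vec_mx @` [set v : 'rV[R]_(a * b) | `|v| <= r].
  apply/seteqP; split=> [A /= Ar|_ /= [v vr <-]].
    exists (mxvec A); last exact: mxvecK.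
    apply: le_trans Ar; apply: mx_norm_le => // i k; rewrite (ord1 i).
    by case/mxvec_indexP: k => j k; rewrite mxvecE coord_le_norm.
  by apply: le_trans vr; apply: mx_norm_le => // i j; rewrite mxE coord_le_norm.
apply: continuous_compact.
  apply: continuous_subspaceT => v; apply: mx_continuous => i j.
  rewrite (_ : (fun _ => _) = fun y : 'rV[R]_(a * b) => y 0 (mxvec_index i j)).
    exact: coord_continuous.
  by apply/funext => y; rewrite mxE.
apply: bounded_closed_compact.
  by exists r; split=> [|s rs v /= vr]; [exact: num_real|exact: le_trans vr (ltW rs)].
apply: (@preimage_closed _ _ (fun v : 'rV[R]_(a * b) => `|v|) [set x | x <= r]) => [v _|].
  exact: norm_continuous.
exact: closed_le.
Qed.

Lemma derive_line m (G : 'rV[R]_m -> R) (t v : 'rV[R]_m) (h : R) :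
  derivable G (h *: v + t) v ->
  is_derive h 1 (fun x : R => G (x *: v + t)) ('D_v G (h *: v + t)).
Proof.
have E : (fun x : R => x^-1 *: (G ((x *: 1 + h) *: v + t) - G (h *: v + t))) =
    (fun x => x^-1 *: (G (x *: v + (h *: v + t)) - G (h *: v + t))).
  by apply/funext => x; rewrite [x *: 1]mulr1 scalerDl addrA.
by move=> Gd; apply: DeriveDef; rewrite /derivable /derive /= E.
Qed.

Lemma mvt_line m (G : 'rV[R]_m -> R) (t v : 'rV[R]_m) (r : R) : 0 < r ->
  (forall h, 0 <= h <= r -> derivable G (h *: v + t) v) ->
  exists2 h, 0 <= h <= r & G (r *: v + t) - G t = r * 'D_v G (h *: v + t).
Proof.
move=> r0 Gd.
have Gd' h : 0 <= h <= r -> is_derive h 1 (fun x : R => G (x *: v + t)) ('D_v G (h *: v + t)).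
  by move=> hr; apply: derive_line; exact: Gd.
have [h|h|h hr] := @MVT R (fun x => G (x *: v + t)) (fun h => 'D_v G (h *: v + t)) 0 r r0.
- by rewrite in_itv /= => /andP[? ?]; apply: Gd'; rewrite !ltW.
- apply: derivable_within_continuous => {}h; rewrite in_itv /= => hr.
  by have [] := Gd' h hr.
- rewrite scale0r add0r subr0 => ->; exists h; last by rewrite mulrC.
  by move: hr; rewrite in_itv /= => /andP[? ?]; rewrite !ltW.
Qed.

End Analysis.

Section SmoothExtension.
Variables (R : realType) (N m n : nat) (v : 'I_m.+1 -> 'rV[R]_N).
Variable f : 'rV[R]_N -> 'rV[R]_n.

Section OneExtension.
Variable g : 'rV[R]_m -> 'rV[R]_n.
Hypothesis gf : smooth_extension v f g.

Lemma smooth_ext_eq t : std_simplex t -> f (phi v t) = g t.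
Proof. by case: gf => U [_ [_ [_ +]]]; apply. Qed.

Lemma smooth_ext_derivable t w : std_simplex t -> derivable g t w.
Proof. by case: gf => U [_ [sU [gU _]]] /sU Ut; have [+ _] := gU [::] t Ut; apply. Qed.

Lemma smooth_ext_continuous t : std_simplex t -> {for t, continuous g}.
Proof. by case: gf => U [_ [sU [gU _]]] /sU Ut; have [_ +] := gU [::] t Ut; apply. Qed.

Lemma jac_continuous t : std_simplex t -> {for t, continuous (jac g)}.
Proof.
case: gf => U [_ [sU [gU _]]] /sU Ut; apply: mx_continuous => j k.
rewrite (_ : (fun _ => _) = fun y : 'rV[R]_m => ('D_(delta_mx 0 j) g y) 0 k); last first.
  by apply/funext => y; rewrite mxE.
have [_ gc] := gU [:: delta_mx 0 j] t Ut.
apply: (@continuous_comp _ _ _ (fun y => 'D_(delta_mx 0 j) g y)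
  (fun M : 'rV[R]_n => M 0 k)); [exact: gc|exact: coord_continuous].
Qed.

(** The mean value theorem, for each component, along a coordinate segment; the segment stays in the
    simplex by convexity, and there the Jacobian is uniformly continuous. The Jacobian may thus be
    taken at any nearby [t0]. *)
Lemma axis_estimate e : 0 < e -> exists2 d, 0 < d &
  forall (j : 'I_m) (t t0 : 'rV[R]_m) (r : R), 0 < r < d ->
    std_simplex t -> std_simplex (r *: delta_mx 0 j + t) -> std_simplex t0 ->
    `|t0 - t| < d -> `|g (r *: delta_mx 0 j + t) - g t - r *: row j (jac g t0)| <= r * e.
Proof.
move=> e0.
have [d d0 jacd] := compact_unif_continuous (@std_simplex_compact R m) jac_continuous e0.
(* One half of [d] is for the distance from [t0] to [t], the other for the length of the segment. *)
exists (d / 2); first by rewrite divr_gt0.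
move=> j t t0 r /andP[r0 rd] ts ts' t0s tt0.
have seg h : 0 <= h <= r -> std_simplex (h *: delta_mx 0 j + t).
  case/andP=> h0 hr; case: ts ts' => [ts0 ts1] [_ ts1'].
  have hs : \sum_k (h *: delta_mx 0 j + t) 0 k = h + \sum_k t 0 k.
    under eq_bigr do rewrite mxE; rewrite big_split /=; congr (_ + _).
    rewrite (bigD1 j) //= !mxE !eqxx mulr1 big1 ?addr0 // => k kj.
    by rewrite !mxE (negbTE kj) andbF mulr0.
  have rs : \sum_k (r *: delta_mx 0 j + t) 0 k = r + \sum_k t 0 k.
    under eq_bigr do rewrite mxE; rewrite big_split /=; congr (_ + _).
    rewrite (bigD1 j) //= !mxE !eqxx mulr1 big1 ?addr0 // => k kj.
    by rewrite !mxE (negbTE kj) andbF mulr0.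
  split=> [k|]; last by move: ts1'; rewrite hs rs; lra.
  by rewrite !mxE addr_ge0 // mulr_ge0 //; case: (_ && _).
apply: mx_norm_le => [|a k]; first by rewrite mulr_ge0 // ltW.
rewrite (ord1 a) !mxE.
have gd x : std_simplex x -> derivable (fun y => g y 0 k) x (delta_mx 0 j).
  by move=> xs; have /derivable_mxP := @smooth_ext_derivable x (delta_mx 0 j) xs; apply.
have [h hr ->] := mvt_line r0 (fun h hr => gd _ (seg h hr)).
have -> : 'D_(delta_mx 0 j) (fun y => g y 0 k) (h *: delta_mx 0 j + t) =
    jac g (h *: delta_mx 0 j + t) j k.
  by rewrite mxE derive_mx ?mxE //; apply: smooth_ext_derivable; exact: seg.
have -> : ('D_(delta_mx 0 j) g t0) 0 k = jac g t0 j k by rewrite mxE.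
rewrite -mulrBr normrM (gtr0_norm r0) ler_wpM2l ?ltW //.
rewrite distrC (le_lt_trans _ (jacd t0 (h *: delta_mx 0 j + t) t0s _)) //.
  apply: le_trans (coord_le_norm _ j k); by rewrite !mxE.
rewrite opprD addrCA (le_lt_trans (ler_normD _ _)) // [d]splitr ler_ltD //.
rewrite normrN normrZ; case/andP: hr => h0 hr.
rewrite ger0_norm // -[leRHS]mulr1 ler_pM //; first by rewrite (le_trans hr) // ltW.
by apply: mx_norm_le => // b c; rewrite mxE; case: (_ && _); rewrite ?normr0 ?normr1.
Qed.

End OneExtension.

(* [g] and [g'] agree on the interior of the simplex, which is dense in it. *)
Lemma jac_unique g g' t : smooth_extension v f g -> smooth_extension v f g' ->
  std_simplex t -> jac g t = jac g' t.
Proof.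
move=> gf gf' ts; apply/eqP; rewrite -subr_eq0 -normr_le0.
apply/ler_addgt0Pl => e e0; rewrite addr0.
have e20 : 0 < e / 2 by rewrite divr_gt0.
have /cvgrPdist_lt /(_ _ e20) /nbhs_normP[d d0 jd] := jac_continuous gf ts.
have /cvgrPdist_lt /(_ _ e20) /nbhs_normP[d' d'0 jd'] := jac_continuous gf' ts.
(* The barycentre; moving [t] slightly towards it gives an interior point [u] that is close enough
   to [t] for both Jacobians. *)
pose c : 'rV[R]_m := const_mx (m.+1%:R^-1).
pose s := Num.min 1 (Num.min d d' / 2 / (`|t - c| + 1)).
have tc0 : 0 < `|t - c| + 1 by rewrite ltr_wpDl.
have s0 : 0 < s by rewrite lt_min ltr01 !divr_gt0 // lt_min d0.
have s1 : s <= 1 by rewrite ge_min lexx.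
pose u := (1 - s) *: t + s *: c.
have tu : `|t - u| < Num.min d d'.
  have -> : t - u = s *: (t - c).
    by rewrite /u scalerBl scale1r scalerBr opprD opprB addrA subrKC.
  rewrite normrZ gtr0_norm // (@le_lt_trans _ _ (s * (`|t - c| + 1))) //.
    by rewrite ler_wpM2l ?ltW // ltrDl.
  rewrite -ltr_pdivlMr // gt_min; apply/orP; right.
  rewrite ltr_pdivlMr // divfK ?gt_eqF // ltr_pdivrMr // mulr_natr mulr2n ltrDr.
  by rewrite lt_min d0.
have ug : \forall y \near u, g y = g' y.
  (* All barycentric coordinates of [u] are at least [r]. The radius is divided by [m.+1] once more
     because the coordinate at [ord0] collects [m] errors. *)
  pose r := s / m.+1%:R.
  have r0 : 0 < r by rewrite divr_gt0.
  apply/nbhs_normP; exists (r / m.+1%:R); first by rewrite /= divr_gt0.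
  move=> y /= uy; suff ys : std_simplex y.
    by rewrite -(smooth_ext_eq gf ys) (smooth_ext_eq gf' ys).
  have yu k : `|u 0 k - y 0 k| <= r / m.+1%:R.
    apply: le_trans (ltW uy); have := coord_le_norm (u - y) 0 k.
    by rewrite !mxE.
  have rm : r / m.+1%:R <= r.
    by rewrite ler_pdivrMr // ler_peMr ?ler1n // ltW.
  case: ts => t0 t1; split=> [k|].
    have : r <= u 0 k.
      by rewrite !mxE /r lerDr mulr_ge0 // subr_ge0.
    move: (yu k) rm; rewrite ler_norml; move: (r / _) (u 0 k) (y 0 k) => r' uk yk.
    by move=> /andP[? ?] ? ?; lra.
  have us : \sum_k u 0 k <= 1 - r.
    have -> : \sum_k u 0 k = (1 - s) * \sum_k t 0 k + m%:R * r.
      under eq_bigr do rewrite !mxE; rewrite big_split /= -mulr_sumr; congr (_ + _).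
      by rewrite sumr_const card_ord mulr_natl.
    have mr : m%:R * r = s - r.
      have : m.+1%:R * r = s by rewrite mulrC divfK // pnatr_eq0.
      by rewrite -natr1 mulrDl mul1r => <-; rewrite addrK.
    have : (1 - s) * \sum_k t 0 k <= 1 - s by rewrite ler_piMr ?subr_ge0.
    by rewrite mr; lra.
  have : \sum_k y 0 k <= \sum_k u 0 k + r.
    apply: (@le_trans _ _ (\sum_k (u 0 k + r / m.+1%:R))).
      apply: ler_sum => k _; move: (yu k); rewrite ler_norml.
      by move: (r / _) (u 0 k) (y 0 k) => r' uk yk /andP[? ?]; lra.
    rewrite big_split /= lerD2l sumr_const card_ord -[_ *+ m]mulr_natr.
    by rewrite mulrAC ler_pdivrMr // (ler_wpM2l (ltW r0)) // ler_nat.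
  by lra.
have uu : jac g u = jac g' u.
  by apply/matrixP => j k; rewrite !mxE; congr (_ _ _ _); exact: near_eq_derive.
rewrite -(subrKA (jac g u)) (le_trans (ler_normD _ _)) // [e]splitr lerD //.
  by apply/ltW/jd => /=; move: tu; rewrite lt_min => /andP[].
by rewrite uu distrC; apply/ltW/jd' => /=; move: tu; rewrite lt_min => /andP[].
Qed.

(** Membership with a margin in all three entries: it absorbs the diameter of a small simplex, the
    deviation of the values from [g], and later corrections of the slope. *)
Definition jet_good (Rl : set ('rV[R]_N * 'rV[R]_n * 'M[R]_(m, n)))
    (g : 'rV[R]_m -> 'rV[R]_n) (t : 'rV[R]_m) (r : R) (A : 'M[R]_(m, n)) : Prop :=
  forall t' y A', std_simplex t' -> `|t' - t| < r -> `|y - g t| < r -> `|A' - A| < r ->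
    Rl (phi v t', y, A').

(** At a single jet, density provides [A'] and openness a margin around it. Continuity of [phi v],
    [g] and [jac g] lets the same [A'] serve all nearby jets, and compactness makes the margin
    uniform. *)
Lemma jet_porous Rl g b e : smooth_extension v f g ->
  open_relation v Rl -> fiberwise_dense v Rl -> 0 < e ->
  exists2 r, 0 < r & forall t A, std_simplex t -> `|A - jac g t| <= b ->
    exists2 A', `|A' - A| <= e & jet_good Rl g t r A'.
Proof.
move=> gf [_ [G [Go RlE]]] Rld e0.
have phis t : std_simplex t -> simplex_set v (phi v t) by move=> ts; exists t.
(* Using the offset from the Jacobian instead of the slope makes the compact set a product. The
   premise on [tE.1] stays inside because the neighbourhoods in the covering argument leave the
   simplex. *)
pose good r (tE : 'rV[R]_m * 'M[R]_(m, n)) := std_simplex tE.1 ->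
  exists2 A', `|A' - (jac g tE.1 + tE.2)| <= e & jet_good Rl g tE.1 r A'.
have cK := compact_setX (@std_simplex_compact R m) (@mx_ball_compact R m n b).
have [[t E] [ts Eb]|r r0 rP] := @compact_near_pos R _ _ good cK; last first.
  exists r => // t A ts Ab.
  have [A' A'A A'r] := rP (t, A - jac g t) (conj ts Ab) ts.
  by exists A' => //; move: A'A; rewrite /= subrKC.
have [A' [A'A RA']] : exists A', `|A' - (jac g t + E)| < e / 2 /\ Rl (phi v t, g t, A').
  have [||A' [A'A RA']] := Rld _ (g t) (phis t ts) (ball (jac g t + E) (e / 2)).
  - by exists (jac g t + E); apply: ballxx; rewrite divr_gt0.
  - by apply: ball_open; rewrite divr_gt0.
  - by exists A'; split=> //; move: A'A; rewrite -ball_normE /= distrC.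
have Onb : nbhs (phi v t, g t, A') G.
  by apply: open_nbhs_nbhs; split=> //; move: RA'; rewrite RlE => -[].
have /nbhs_ballP[d /= d0 dO] := Onb.
have dO' x y A : `|phi v t - x| < d -> `|g t - y| < d -> `|A' - A| < d -> G (x, y, A).
  by move=> xd yd Ad; apply: dO; split; [split|]; rewrite -ball_normE.
have d20 : 0 < d / 2 by rewrite divr_gt0.
have /cvgrPdist_lt /(_ _ d0) /nbhs_normP[a /= a0 phia] := @phi_continuous R N m v t.
have /cvgrPdist_lt /(_ _ d20) /nbhs_normP[a1 /= a10 ga] := smooth_ext_continuous gf ts.
have e40 : 0 < e / 4 by rewrite divr_gt0.
have /cvgrPdist_lt /(_ _ e40) /nbhs_normP[a2 /= a20 ja] := jac_continuous gf ts.
exists (Num.min (a / 2) (d / 2)); first by rewrite lt_min !divr_gt0.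
exists (ball t (Num.min (a / 2) (Num.min a1 a2)), ball E (e / 4)).
  split; apply: nbhsx_ballx => //.
  by rewrite !lt_min a10 a20 divr_gt0.
move=> [t1 E1] [/=]; rewrite -!ball_normE /= !lt_min => /and3P[t1a t1a1 t1a2] E1e.
move=> r /andP[r0]; rewrite lt_min => /andP[ra rd] t1s.
have {}ga : `|g t - g t1| < d / 2 by exact: ga.
have {}ja : `|jac g t - jac g t1| < e / 4 by exact: ja.
exists A' => /=.
  have -> : A' - (jac g t1 + E1) =
      (A' - (jac g t + E)) + (jac g t - jac g t1) + (E - E1).
    by apply/matrixP => j k; rewrite !mxE; ring.
  rewrite (le_trans (ler_normD _ _)) // (le_trans (lerD (ler_normD _ _) (lexx _))) //.
  by move: A'A; lra.
move=> t2 y A2 t2s /= t2r yr A2r; rewrite RlE; split; last exact: phis.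
apply: dO'.
- apply: phia => /=; rewrite -(subrKA t1) (le_lt_trans (ler_normD _ _)) //.
  by rewrite [a]splitr ltrD // distrC (lt_trans t2r).
- rewrite -(subrKA (g t1)) (le_lt_trans (ler_normD _ _)) //.
  by rewrite [d]splitr ltrD // distrC (lt_trans yr).
- by rewrite distrC (lt_trans A2r) // (lt_trans rd) // gtr_pMr // invf_lt1 // ltr1n.
Qed.

End SmoothExtension.

(** * Continuity of the piecewise linear map *)

Section Continuity.
Variable R : realType.

Lemma max_op_continuous : continuous (fun x : R * R => Num.max x.1 x.2).
Proof.
by move=> x; apply: (@continuous_max R _ fst snd); [exact: cvg_fst|exact: cvg_snd].
Qed.

Lemma min_op_continuous : continuous (fun x : R * R => Num.min x.1 x.2).
Proof.
by move=> x; apply: (@continuous_min R _ fst snd); [exact: cvg_fst|exact: cvg_snd].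
Qed.

Lemma sum_continuous (T : topologicalType) (U : normedModType R) (I : Type)
    (r : seq I) (P : pred I) (F : I -> T -> U) :
  (forall i, P i -> continuous (F i)) -> continuous (fun x => \sum_(i <- r | P i) F i x).
Proof. by apply: (@continuous_big U I +%R 0); exact: add_continuous. Qed.

Lemma hat_continuous (T : topologicalType) p (d : 'I_p -> T -> R) :
  (forall k, continuous (d k)) -> continuous (fun x => hat (d ^~ x)).
Proof.
move=> dc x.
apply: (@continuous_max R T (cst 0)
  (fun x => 1 - \big[Num.max/0]_k d k x + \big[Num.min/0]_k d k x)).
  exact: cst_continuous.
apply: (@continuousD R R^o T (fun x => 1 - \big[Num.max/0]_k d k x)).
  apply: (@continuousB R R^o T (cst 1)); first exact: cst_continuous.
  exact: (continuous_big max_op_continuous).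
exact: (continuous_big min_op_continuous).
Qed.

(** The pasting lemma for a finite closed cover; the induction also carries the closedness of the
    partial unions. *)
Lemma within_fin_bigcup (T U : topologicalType) (I : finType) (A : I -> set T) (f : T -> U) :
  (forall i, closed (A i)) -> (forall i, {within A i, continuous f}) ->
  {within \bigcup_(i in [set: I]) A i, continuous f}.
Proof.
move=> Ac Af; pose B (r : seq I) := [set x | exists2 i, i \in r & A i x].
have -> : \bigcup_(i in [set: I]) A i = B (enum I).
  apply/seteqP; split=> x [i _ Ai]; exists i => //; by rewrite mem_enum.
suff [] : closed (B (enum I)) /\ {within B (enum I), continuous f} by [].
elim: (enum I) => [|i r [rc rf]].
  have -> : B [::] = set0 by apply/seteqP; split=> x // [].
  by split; [exact: closed0|exact: continuous_subspace0].
have -> : B (i :: r) = A i `|` B r.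
  apply/seteqP; split=> x.
    by case=> j /[!inE] /predU1P[-> ?|jr ?]; [left|right; exists j].
  by case=> [Ai|[j jr Aj]]; [exists i|exists j] => //; rewrite inE ?eqxx // jr orbT.
by split; [exact: closedU|exact: withinU_continuous].
Qed.

Lemma small_exp (d : R) : 0 < d -> exists l0, forall l, (l0 <= l)%N -> (2 ^+ l)^-1 < d.
Proof.
move=> d0; exists (Num.bound d^-1) => l ll.
rewrite invf_plt ?posrE ?exprn_gt0 //.
have := archi_boundP (ltW (etrans (invr_gt0 d) d0)) => /lt_trans; apply.
by rewrite -natrX ltr_nat (leq_ltn_trans ll) // ltn_expl.
Qed.

Variables (N m n p q : nat).
Variables (V : 'I_p -> 'rV[R]_N) (top : 'I_q -> 'I_m.+1 -> 'I_p).
Hypothesis cplx : simplicial_complex V top.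
Local Notation vtx i := (fun j => V (top i j)).

Lemma simplex_set_closed i : closed (simplex_set (vtx i)).
Proof.
apply: compact_closed; first exact: norm_hausdorff.
apply: continuous_compact (@std_simplex_compact R m).
by apply: continuous_subspaceT; exact: phi_continuous.
Qed.

Lemma chart_continuous i : continuous (chart V top i).
Proof.
have -> : chart V top i =
    (fun w : 'rV[R]_N => w *m pinvmx (edge_mx (vtx i))) \o (fun z => z - V (top i ord0)).
  by [].
move=> z; apply: continuous_comp; last exact: mulmxr_continuous.
apply: (@continuousB R 'rV[R]_N 'rV[R]_N id (cst (V (top i ord0)))) => //.
exact: cst_continuous.
Qed.

Lemma bary_continuous j : continuous (fun t : 'rV[R]_m => bary t j).
Proof.
move=> t; case: (unliftP ord0 j) => [k|] ->.
  under [X in continuous_at _ X]eq_fun do rewrite baryS; exact: coord_continuous.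
under [X in continuous_at _ X]eq_fun do rewrite bary0.
apply: (@continuousB R R^o 'rV[R]_m (cst 1)); first exact: cst_continuous.
by apply: (@sum_continuous _ R^o) => k _; exact: coord_continuous.
Qed.

(** On each closed top simplex the map agrees with a composition of [chart], partial sums and hats
    that is continuous on the whole space. *)
Lemma pl_map_continuous l (h : lattice p l -> 'rV[R]_n) :
  {within polyhedron V top, continuous (pl_map V top h)}.
Proof.
apply: within_fin_bigcup => [i|i]; first exact: simplex_set_closed.
pose F z := pl_interp h (cumul top i (chart V top i z)).
suff Fc : continuous F.
  apply: subspace_eq_continuous (continuous_subspaceT Fc).
  by move=> z /set_mem[t ts <-] /=; rewrite /from_subspace (pl_mapE cplx) // /F (phiK cplx).
apply: sum_continuous => W _ z.
apply: (@continuousZr_tmp R 'rV[R]_n 'rV[R]_N).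
apply: (@hat_continuous _ _ (fun k z =>
  2 ^+ l * cumul top i (chart V top i z) k - (W k : nat)%:R)).
move=> k {}z; apply: (@continuousB R R^o 'rV[R]_N); last exact: cst_continuous.
apply: continuousM; first exact: cst_continuous.
apply: (@sum_continuous _ R^o) => j _ {}z.
apply: (@continuous_comp _ _ _ (chart V top i) (fun t => bary t j)).
  exact: chart_continuous.
exact: bary_continuous.
Qed.

Lemma pl_map_affine_on l (h : lattice p l -> 'rV[R]_n) i c pi :
  @cube_simplex R m l c pi `<=` @iota_simplex R m ->
  exists b, affine_on (crystal_simplex (vtx i) c pi) (pl_map V top h)
    (pinvmx (edge_mx (vtx i)) *m crystal_slope top c pi i h) b.
Proof.
move=> adm; have [b hb] := pl_map_affine cplx i h adm.
exists (b - V (top i ord0) *m (pinvmx (edge_mx (vtx i)) *m crystal_slope top c pi i h)).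
move=> _ [x xc <-]; rewrite iota_inv_phi hb // addrCA -mulmxBl addrC; congr (_ + _).
rewrite mulmxA; congr (_ *m _); symmetry; exact: (@phiK _ _ _ _ _ _ _ cplx i).
Qed.

Lemma edge_slope l (h : lattice p l -> 'rV[R]_n) i c pi :
  edge_mx (vtx i) *m (pinvmx (edge_mx (vtx i)) *m crystal_slope top c pi i h) =
  crystal_slope top c pi i h.
Proof. by rewrite mulmxA mulmxVp ?mul1mx //; case: cplx => _ [_ [+ _]]; apply. Qed.

Lemma pl_map_dist l (h : lattice p l -> 'rV[R]_n) i c pi x y r :
  @cube_simplex R m l c pi `<=` @iota_simplex R m -> @cube_simplex R m l c pi x ->
  (forall t, `|h (crystal_vertex top c pi i t) - y| <= r) ->
  `|pl_map V top h (phi (vtx i) (tcoord x)) - y| <= r.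
Proof.
move=> adm xc hr; have [mu [mu0 mu1 ->]] := pl_map_convex cplx i h adm xc.
have -> : y = \sum_t mu t *: y by rewrite -scaler_suml mu1 scale1r.
rewrite -sumrB (le_trans (ler_norm_sum _ _ _)) // -[leRHS]mul1r -mu1 mulr_suml.
by apply: ler_sum => t _; rewrite -scalerBr normrZ ger0_norm // ler_wpM2l.
Qed.

End Continuity.

(** * Approximation by sampling *)

Section Displacement.
Variables (R : realType) (m : nat).

(** Row [a] is the image of the cube axis [a] under the linear part of [tcoord]: the basis vector
    [a - 1] minus the basis vector [a], the former being absent for [a = 0]. *)
Definition axis_mx : 'M[R]_m := \matrix_(a, j) ((j.+1 == a)%:R - (j == a)%:R).

Lemma node_shift (x : 'rV[R]_m) (r : R) (a : 'I_m) s : (s <= m.+1)%N ->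
  node (r *: delta_mx 0 a + x) s = r * (s == a.+1)%:R + node x s.
Proof.
case/bnode_cases => [->|[b ->]|->].
- by rewrite mulr0 add0r.
- by rewrite !nodeS !mxE eqxx.
- by rewrite !node_last eqSS gtn_eqF ?mulr0 ?add0r.
Qed.

Lemma tcoord_shift (x : 'rV[R]_m) (r : R) (a : 'I_m) :
  tcoord (r *: delta_mx 0 a + x) = r *: row a axis_mx + tcoord x.
Proof.
apply/rowP => j; have jm : (j.+2 <= m.+1)%N := ltn_ord j.
rewrite mxE (node_shift _ _ _ jm) (node_shift _ _ _ (ltnW jm)).
by rewrite !mxE !eqSS; move: (node _ _) (node _ _) => u w; rewrite -val_eqE /=; ring.
Qed.

Lemma lower_axis : lower_mx R m *m axis_mx = - 1%:M.
Proof.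
have : axis_mx *m - lower_mx R m = 1%:M.
  apply/row_matrixP => a; rewrite row_mul row1 mulmxN.
  have := tcoordK (1 *: delta_mx 0 a + 0 : 'rV[R]_m).
  rewrite tcoord_shift mulmxDl opprD addrCA tcoordK addr0 scale1r => ->.
  by rewrite scale1r addr0.
by move/mulmx1C; rewrite mulNmx => /(congr1 -%R); rewrite opprK.
Qed.

Lemma node_dist (x y : 'rV[R]_m) s : (s <= m.+1)%N -> `|node x s - node y s| <= `|x - y|.
Proof.
case/bnode_cases => [->|[b ->]|->]; rewrite ?nodeS ?node_last ?subrr ?normr0 //.
by have := coord_le_norm (x - y) 0 b; rewrite !mxE.
Qed.

Lemma tcoord_dist (x y : 'rV[R]_m) : `|tcoord x - tcoord y| <= 2 * `|x - y|.
Proof.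
apply: mx_norm_le => [|i j]; first by rewrite mulr_ge0.
have jm : (j.+2 <= m.+1)%N := ltn_ord j.
have := lerD (node_dist x y jm) (node_dist x y (ltnW jm)).
rewrite mulr_natl mulr2n; apply: le_trans; rewrite (le_trans _ (ler_normB _ _)) //.
have E (a b c d : R) : a - b - (c - d) = a - c - (b - d) by ring.
by rewrite !mxE E.
Qed.

Lemma cube_dist l (c : 'I_m -> 'I_(2 ^ l)) (pi : {perm 'I_m}) x y :
  @cube_simplex R m l c pi x -> @cube_simplex R m l c pi y -> `|x - y| <= (2 ^+ l)^-1.
Proof.
move=> [x' [x01 [_ ->]]] [y' [y01 [_ ->]]].
rewrite -scalerBr opprD addrACA subrr add0r normrZ ger0_norm ?invr_ge0 ?exprn_ge0 //.
rewrite ler_piMr ?invr_ge0 ?exprn_ge0 //; apply: mx_norm_le => // i j.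
rewrite !mxE (ord1 i) ler_norml; move: (x01 j) (y01 j).
by move: (x' 0 j) (y' 0 j) => a b /andP[? ?] /andP[? ?]; apply/andP; split; lra.
Qed.

Lemma corner_shift l (c : 'I_m -> 'I_(2 ^ l)) (pi : {perm 'I_m}) a :
  corner R c pi (rank pi a) =
  (2 ^+ l)^-1 *: delta_mx 0 a + corner R c pi (rank pi a).+1.
Proof.
rewrite /corner /cube_point -scalerDr; congr (_ *: _); rewrite addrCA; congr (_ + _).
apply/rowP => b; rewrite !mxE eqxx /=.
have -> : (b == a) = (rank pi a == rank pi b).
  by rewrite /rank (inj_eq val_inj) (inj_eq perm_inj) eq_sym.
by case: ltngtP => _; rewrite ?addr0 ?add0r.
Qed.

End Displacement.

Section Sampling.
Variables (R : realType) (N m n p q : nat).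
Variables (V : 'I_p -> 'rV[R]_N) (top : 'I_q -> 'I_m.+1 -> 'I_p).
Hypothesis cplx : simplicial_complex V top.
Local Notation vtx i := (fun j => V (top i j)).
Variable s : 'rV[R]_N -> 'rV[R]_n.

Definition sample l (W : lattice p l) : 'rV[R]_n :=
  s (of_cumul V (fun k => (2 ^+ l)^-1 * (W k : nat)%:R)).

Lemma sample_vertex l c pi i t :
  sample (@crystal_vertex m p q top l c pi i t) =
  s (phi (vtx i) (tcoord (corner R c pi t))).
Proof.
rewrite /sample -(of_cumulE V); congr (s (of_cumul V _)); apply/funext => k.
rewrite (crystal_vertex_cumul cplx) mulrA mulVf ?mul1r //.
Qed.

(** A cube edge becomes a difference of two coordinate directions under [tcoord], so its difference
    quotient splits into two instances of [axis_estimate]. The level [l0] is uniform in the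
    simplices of the subdivision. *)
Lemma sample_slope_close i g e : smooth_extension (vtx i) s g -> 0 < e ->
  exists l0, forall l c pi x, (l0 <= l)%N ->
    @cube_simplex R m l c pi `<=` @iota_simplex R m -> @cube_simplex R m l c pi x ->
    `|crystal_slope top c pi i (@sample l) - jac g (tcoord x)| <= e.
Proof.
move=> gf e0.
(* Bounds the effect of [lower_mx]; the later halving of [e / K] is for the two coordinate steps. *)
pose K : R := m%:R * `|lower_mx R m| + 1.
have K0 : 0 < K by rewrite ltr_wpDl // mulr_ge0.
have e'0 : 0 < e / K / 2 by rewrite !divr_gt0.
have [d d0 gd] := axis_estimate gf e'0.
(* The distance from [tcoord x] to [mid] below is at most three times the mesh: [tcoord] at most
   doubles distances, and [mid] is one more step away. *)
have [l0 l0d] := small_exp (divr_gt0 d0 (ltr0n R 4)).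
exists l0 => l c pi x ll adm xc.
pose r : R := (2 ^+ l)^-1.
have r0 : 0 < r by rewrite invr_gt0 exprn_gt0.
have rd : r < d / 4 by exact: l0d.
pose J := jac g (tcoord x).
have std y : @cube_simplex R m l c pi y -> std_simplex (tcoord y).
  by move=> yc; apply: tcoord_std; exact: adm.
have cube := corner_cube R c pi.
suff diff_close : `|2 ^+ l *: crystal_diff top c pi i (@sample l) - axis_mx R m *m J| <= e / K.
  have -> : crystal_slope top c pi i (@sample l) - J =
      - (lower_mx R m *m (2 ^+ l *: crystal_diff top c pi i (@sample l) - axis_mx R m *m J)).
    by rewrite mulmxBr mulmxA lower_axis mulNmx mul1mx opprD opprK.
  rewrite normrN (le_trans (mulmx_norm_le _ _)) //.
  rewrite (@le_trans _ _ (K * (e / K))) // ?ler_pM ?mulr_ge0 //.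
    by rewrite lerDl.
  by rewrite mulrC divfK // gt_eqF.
apply: mx_norm_le => [|a b]; first by rewrite divr_ge0 ?(ltW e0) ?(ltW K0).
pose t1 := tcoord (corner R c pi (rank pi a)).
pose t0 := tcoord (corner R c pi (rank pi a).+1).
have t1s : std_simplex t1 by exact: std.
have t0s : std_simplex t0 by exact: std.
have t10 : t1 = r *: row a (axis_mx R m) + t0 by rewrite /t1 corner_shift tcoord_shift.
have xt0 : `|tcoord x - t0| <= 2 * r.
  rewrite (le_trans (tcoord_dist _ _)) // ler_wpM2l //.
  exact: cube_dist xc (cube _).
have gE t : std_simplex t -> s (phi (vtx i) t) = g t by move=> ts; exact: smooth_ext_eq gf _ ts.
have diffE : (2 ^+ l *: crystal_diff top c pi i (@sample l)) a b = 2 ^+ l * (g t1 - g t0) 0 b.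
  by rewrite !mxE !sample_vertex -/t1 -/t0 !gE.
rewrite mxE diffE [X in _ + X]mxE [X in _ - X]mxE.
clear diffE; clearbody t1 t0.
(* Both ends of the edge are reached from [mid] by one step along a coordinate, or by none for [t1]
   if [a = 0]. It lies in the simplex since its coordinate [a] is that of [t1]. *)
pose mid := t0 - r *: delta_mx 0 a.
have t0mid : t0 = r *: delta_mx 0 a + mid by rewrite /mid subrKC.
have mids : std_simplex mid.
  case: (t0s) => t00 t01; case: (t1s) => t10' _; split=> [j|].
    have [->|ja] := eqVneq j a; last by rewrite !mxE (negbTE ja) andbF mulr0 subr0.
    have := t10' a; rewrite t10 !mxE !eqxx gtn_eqF // => h.
    by move: h; rewrite sub0r mulrN1 mulr1 addrC.
  have -> : \sum_j mid 0 j = \sum_j t0 0 j - r.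
    under eq_bigr do rewrite !mxE eqxx /=.
    rewrite sumrB (bigD1 a) //= [in X in _ - X](bigD1 a) //= eqxx mulr1.
    rewrite [X in _ - (_ + X)]big1 ?addr0 // => j /negbTE ->.
    by rewrite mulr0.
  by rewrite lerBlDr (le_trans t01) // lerDl ltW.
have xmid : `|tcoord x - mid| < d.
  have : `|r *: delta_mx 0 a : 'rV[R]_m| <= r.
    rewrite normrZ gtr0_norm // ler_piMr ?(ltW r0) //; apply: mx_norm_le => // i' j.
    by rewrite mxE; case: (_ && _); rewrite ?normr0 ?normr1.
  have := ler_normD (tcoord x - t0) (r *: delta_mx 0 a).
  by rewrite /mid opprB addrA addrAC; move: xt0 rd; lra.
have xs : std_simplex (tcoord x) by exact: std.
have r01 : 0 < r < d by rewrite r0 (lt_trans rd) // gtr_pMr // invf_lt1 // ltr1n.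
have est0 : `|g t0 - g mid - r *: row a J| <= r * (e / K / 2).
  by rewrite {1}t0mid; apply: gd => //; rewrite -t0mid.
have est1 : `|g t1 - g mid - r *: (row a (axis_mx R m) *m J + row a J)| <= r * (e / K / 2).
  have [a0|a0] := posnP a.
    have rowa : row a (axis_mx R m) = - delta_mx 0 a.
      by apply/rowP => j; rewrite !mxE eqxx a0 sub0r -val_eqE /= a0.
    have -> : t1 = mid by rewrite t10 rowa scalerN addrC.
    rewrite rowa mulNmx -rowE addNr scaler0 !subr0 subrr normr0.
    by rewrite mulr_ge0 // ltW.
  have am : (a.-1 < m)%N by rewrite (leq_ltn_trans (leq_pred _)).
  pose a' := Ordinal am.
  have rowa : row a (axis_mx R m) = delta_mx 0 a' - delta_mx 0 a.
    apply/rowP => j; rewrite !mxE eqxx -!val_eqE /=; congr (_%:R - _).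
    by congr nat_of_bool; apply/eqP/eqP; lia.
  have t1mid : t1 = r *: delta_mx 0 a' + mid.
    by rewrite t10 rowa scalerBr /mid -addrA (addrC (- _)).
  rewrite rowa mulmxBl -!rowE subrK {1}t1mid; apply: gd => //.
  by rewrite -t1mid.
have -> : 2 ^+ l * (g t1 - g t0) 0 b - \sum_j axis_mx R m a j * J j b =
   r^-1 * ((g t1 - g mid - r *: (row a (axis_mx R m) *m J + row a J)) 0 b
         - (g t0 - g mid - r *: row a J) 0 b).
  rewrite /r invrK; clearbody J; rewrite !mxE.
  have -> : \sum_j row a (axis_mx R m) 0 j * J j b = \sum_j axis_mx R m a j * J j b.
    by apply: eq_bigr => j _; rewrite [in LHS]mxE.
  have : 2 ^+ l != 0 :> R by rewrite expf_neq0 // pnatr_eq0.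
  move: (2 ^+ l) (\sum_j _) (g t1 0 b) (g t0 0 b) (g mid 0 b) (J a b) => u S x1 x2 x3 x4 u0.
  by field.
rewrite normrM gtr0_norm ?invr_gt0 // mulrC ler_pdivrMr //.
rewrite (le_trans (ler_normB _ _)) // mulrC [e / K]splitr mulrDr lerD //.
  exact: le_trans (coord_le_norm _ 0 b) est1.
exact: le_trans (coord_le_norm _ 0 b) est0.
Qed.

End Sampling.

(** * Jiggling *)

Lemma fin_pos_bound (R : realType) (I : finType) (P : I -> R -> Prop) :
  (forall i r r', r' <= r -> P i r -> P i r') ->
  (forall i, exists2 r, 0 < r & P i r) -> exists2 r, 0 < r & forall i, P i r.
Proof.
move=> Ple Pex.
have /choice[r rP] i : exists r, 0 < r /\ P i r by have [r ? ?] := Pex i; exists r.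
exists (\big[Num.min/1]_i r i).
  by apply/bigmin_gtP; split=> // i _; case: (rP i).
by move=> i; apply: Ple (rP i).2; exact: bigmin_le.
Qed.

(** A colour is a top simplex, a parity and a permutation, so the list of colours is the same at all
    levels. No factor [2 ^+ l] occurs because the vertex values will move by [w] divided by it. *)
Lemma crystal_perturb (R : realType) (N m n p q : nat)
    (V : 'I_p -> 'rV[R]_N) (top : 'I_q -> 'I_m.+1 -> 'I_p)
    (adm : forall l, ('I_m -> 'I_(2 ^ l)) -> {perm 'I_m} -> Prop)
    (A0 : forall l, 'I_q -> ('I_m -> 'I_(2 ^ l)) -> {perm 'I_m} -> 'M[R]_(m, n))
    (good : forall l, 'I_q -> ('I_m -> 'I_(2 ^ l)) -> {perm 'I_m} -> R -> 'M[R]_(m, n) -> Prop)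
    (eta : R) :
  simplicial_complex V top ->
  (forall l i c pi r A A', good l i c pi r A -> `|A' - A| <= r / 2 ->
    good l i c pi (r / 2) A') ->
  (forall l i c pi r r' A, r' <= r -> good l i c pi r A -> good l i c pi r' A) ->
  (forall e, 0 < e -> exists2 r, 0 < r & forall l i c pi A, adm l c pi ->
    `|A - A0 l i c pi| <= 1 -> exists2 A', `|A' - A| <= e & good l i c pi r A') ->
  0 < eta -> eta <= 1 ->
  exists2 r, 0 < r & forall l, exists w : lattice p l -> 'rV[R]_n,
    (forall W, `|w W| <= 1) /\
    forall i c pi, adm l c pi ->
      let A := lower_mx R m *m crystal_diff top c pi i w in
      `|A| <= eta /\ good l i c pi r (A0 l i c pi - A).
Proof.
move=> cplx good_half good_le porous eta0 eta1.
pose lo := lower_mx R m; pose lo' := invmx lo.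
(* The first summand serves [L_bound] and the second [L_solve]; the last makes [K] at least 1, so
   that a correction of size [eta / K] is at most 1. *)
pose K : R := m%:R * `|lo| * 2 + m%:R * (m%:R * `|lo'|) + 1.
have K1 : 1 <= K by rewrite lerDr addr_ge0 // ?mulr_ge0.
have K0 : 0 < K by apply: lt_le_trans K1.
pose S l := {x : 'I_q * ('I_m -> 'I_(2 ^ l)) * {perm 'I_m} | adm l x.1.2 x.2}.
pose L l (x : S l) (w : lattice p l -> 'rV[R]_n) : 'M[R]_(m, n) :=
  - (lo *m crystal_diff top (sval x).1.2 (sval x).2 (sval x).1.1 w).
pose colour l (x : S l) := ((sval x).1.1, parity (sval x).1.2, (sval x).2).
have L_bound l (x : S l) w e : 0 <= e -> (forall i, `|w i| <= e) -> `|L l x w| <= K * e.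
  move=> e0 we; rewrite normrN (le_trans (mulmx_norm_le _ _)) //.
  apply: (@le_trans _ _ (m%:R * `|lo| * (2 * e))).
    rewrite ler_wpM2l ?mulr_ge0 //; apply: mx_norm_le => [|a b]; first by rewrite mulr_ge0.
    rewrite !mxE mulr_natl mulr2n (le_trans (ler_normB _ _)) // lerD //.
      exact: le_trans (coord_le_norm _ 0 b) (we _).
    exact: le_trans (coord_le_norm _ 0 b) (we _).
  by rewrite mulrA ler_wpM2r // /K -addrA lerDl addr_ge0 // !mulr_ge0.
have [|||||||r r0 rP] := @perturb_colours R 'rV[R]_n 'M[R]_(m, n)
  ('I_q * {ffun 'I_m -> bool} * {perm 'I_m})%type nat S (fun l => lattice p l) colour L
  (fun l x => A0 l (sval x).1.1 (sval x).1.2 (sval x).2)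
  (fun l x => good l (sval x).1.1 (sval x).1.2 (sval x).2) K K0 _ L_bound _ _ _ _
  (enum {: 'I_q * {ffun 'I_m -> bool} * {perm 'I_m}}) (eta / K).
- move=> l x w w'; rewrite /L -opprD -mulmxDr; congr (- (_ *m _)).
  by apply/matrixP => a b; rewrite !mxE; ring.
- move=> l [[i par] pi] B e e0 Be.
  pose B' c := if pselect (adm l c pi) is left h
    then - (lo' *m B (exist _ (i, c, pi) h)) else 0.
  have e'0 : 0 <= m%:R * `|lo'| * e by rewrite !mulr_ge0.
  have [c|w [we wB]] := crystal_diff_solve cplx i pi par (B := B') e'0.
    rewrite /B'; case: pselect => [h|_]; last by rewrite normr0.
    by rewrite normrN (le_trans (mulmx_norm_le _ _)) // ler_wpM2l // mulr_ge0.
  exists w; split=> [W|[[[i' c] pi'] h] [ii' cp pipi']].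
    rewrite (le_trans (we W)) // mulrA ler_wpM2r //.
    by rewrite /K addrAC lerDr addr_ge0 // !mulr_ge0.
  rewrite /= in cp h *; move: ii' pipi' h; rewrite /= => -> -> h.
  rewrite /L /= wB // /B'; case: pselect => // h'.
  rewrite mulmxN opprK mulmxA mulmxV ?lower_mx_unit // mul1mx.
  by congr (B (exist _ _ _)); exact: Prop_irrelevance.
- by move=> l x r A A'; exact: good_half.
- by move=> l x r r' A; exact: good_le.
- move=> e e0; have [r r0 rP] := porous e e0; exists r => // l [[[i c] pi] h] A /=.
  exact: rP.
- by rewrite divr_gt0.
- by rewrite mulrC divfK // gt_eqF.
exists r => // l; have [w [we wP]] := rP l; exists w; split=> [W|i c pi h].
  by rewrite (le_trans (we W)) // ler_pdivrMr // mul1r (le_trans eta1).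
have := wP (exist _ (i, c, pi) h); rewrite mem_enum => /(_ isT) /= wg.
have e0 : 0 <= eta / K by rewrite divr_ge0 // ltW.
have := L_bound l (exist _ (i, c, pi) h) w _ e0 we.
by rewrite normrN mulrC divfK ?gt_eqF.
Qed.

Theorem theorem6p1 (R : realType) (N m n p q : nat)
    (V : 'I_p -> 'rV[R]_N) (top : 'I_q -> 'I_m.+1 -> 'I_p)
    (Rl : 'I_q -> set ('rV[R]_N * 'rV[R]_n * 'M[R]_(m, n))) :
  simplicial_complex V top ->
  (forall i, open_relation (fun j => V (top i j)) (Rl i)) ->
  (forall i, fiberwise_dense (fun j => V (top i j)) (Rl i)) ->
  forall (eps : R), 0 < eps ->
  forall s : 'rV[R]_N -> 'rV[R]_n, piecewise_smooth V top s ->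
  exists (l : nat) (s' : 'rV[R]_N -> 'rV[R]_n),
    piecewise_linear_crystal V top l s' /\
    C1_close_crystal V top l eps s s' /\
    piecewise_solution_crystal V top l Rl s'.
Proof.
move=> cplx Rlo Rld eps eps0 s [_ /choice[g gs]].
pose C : R := (m * n).+1%:R; pose C1 : R := (1 * n).+1%:R.
have C0 : 0 < C by []. have C10 : 0 < C1 by [].
(* Sampling and perturbing each cost [eta] in the slope. The bound 1 keeps every slope considered
   within 2 of the Jacobian, the range in which porosity is invoked. *)
pose eta := Num.min 1 (eps / (4 * C)).
have eta0 : 0 < eta by rewrite lt_min ltr01 divr_gt0 // mulr_gt0.
have eta1 : eta <= 1 by rewrite ge_min lexx.
have etaC : C * (eta + eta) < eps.
  have : C * eta <= eps / 4.
    rewrite (@le_trans _ _ (C * (eps / (4 * C)))) //.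
      by rewrite (ler_wpM2l (ltW C0)) // ge_min lexx orbT.
    by rewrite invfM [leLHS]mulrC -!mulrA mulVf ?mulr1 // gt_eqF.
  by rewrite mulrDr; move: eps0; lra.
have /choice[l0 l0P] i := sample_slope_close cplx (gs i) eta0.
pose A0 l i c pi := crystal_slope top c pi i (@sample R N n p V s l).
pose base l (c : 'I_m -> 'I_(2 ^ l)) pi := tcoord (corner R c pi m).
(* The lower bound on the level is part of admissibility, since [crystal_perturb] treats all levels
   at once and sampled slopes are controlled only from that bound on. *)
pose adm l c pi := @cube_simplex R m l c pi `<=` @iota_simplex R m /\
  (\max_i l0 i <= l)%N.
have base_std l c pi : adm l c pi -> std_simplex (base l c pi).
  by case=> h _; apply: tcoord_std; apply: h; exact: corner_cube.
have A0_close l i c pi x : adm l c pi -> @cube_simplex R m l c pi x ->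
    `|A0 l i c pi - jac (g i) (tcoord x)| <= eta.
  by case=> h ll xc; apply: l0P => //; apply: leq_trans ll; exact: leq_bigmax.
pose good l i c pi r A := jet_good (fun j => V (top i j)) (Rl i) (g i) (base l c pi) r A.
have [|||r r0 rP] := @crystal_perturb R N m n p q V top adm A0 good eta cplx _ _ _ eta0 eta1.
- move=> l i c pi r A A' Ag A'A t y A'' ts tr yr A''r.
  have r2 : r / 2 <= r by have := le_lt_trans (normr_ge0 _) tr; lra.
  apply: Ag => //; [exact: lt_le_trans r2|exact: lt_le_trans r2|].
  rewrite -(subrKA A') (le_lt_trans (ler_normD _ _)) // [r]splitr ltr_leD //.
- move=> l i c pi r r' A r'r Ag t y A' ts tr yr A'r.
  by apply: Ag => //; apply: lt_le_trans r'r.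
- move=> e e0.
  have [||r r0 rP] := @fin_pos_bound R 'I_q (fun i r => forall t A, std_simplex t ->
    `|A - jac (g i) t| <= 2 -> exists2 A', `|A' - A| <= e &
      jet_good (fun j => V (top i j)) (Rl i) (g i) t r A').
  + move=> i r r' r'r H t A ts At; have [A' A'A A'g] := H t A ts At; exists A' => //.
    by move=> t' y A'' t's tr yr A'r; apply: A'g => //; apply: lt_le_trans r'r.
  + by move=> i; exact: (jet_porous 2 (gs i) (Rlo i) (Rld i) e0).
  exists r => // l i c pi A h AA0; apply: rP; first exact: base_std.
  rewrite -(subrKA (A0 l i c pi)) (le_trans (ler_normD _ _)) //.
  have := A0_close l i c pi _ h (corner_cube R c pi m).
  by move: AA0 eta1; rewrite -/(base l c pi); lra.
(* The tolerance for values: [r] for staying in the relation, [eps / C1] for closeness. *)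
pose rho := Num.min r (eps / C1).
have rho0 : 0 < rho by rewrite lt_min r0 divr_gt0.
have [||d d0 dP] := @fin_pos_bound R 'I_q (fun i d => forall t t', std_simplex t ->
    `|t - t'| < d -> `|g i t - g i t'| < rho / 4).
- by move=> i d d' d'd H t t' ts tt'; apply: H => //; apply: lt_le_trans d'd.
- move=> i; have r4 : 0 < rho / 4 by rewrite divr_gt0.
  have gc := smooth_ext_continuous (gs i).
  have [e e0 H] := compact_unif_continuous (@std_simplex_compact R m) gc r4.
  by exists e => // t t' ts; apply: H.
(* The mesh is fixed only after all radii. The halves compensate the factor 2 in [tcoord_dist];
   [rho / 4] bounds the shift of the vertex values. *)
have small0 : 0 < Num.min (Num.min (d / 2) (r / 2)) (rho / 4).
  by rewrite !lt_min !divr_gt0.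
have [l1 l1P] := small_exp small0.
pose l := maxn (\max_i l0 i) l1; pose u : R := (2 ^+ l)^-1.
have u0 : 0 <= u by rewrite invr_ge0 exprn_ge0.
have := l1P l (leq_maxr _ _); rewrite -/u !lt_min => /andP[/andP[ud ur] urho].
have [w [w1 wP]] := rP l.
(* The factor [u] cancels [2 ^+ l] in [crystal_slope]: the slopes move by the full correction, the
   values by at most [u]. *)
pose h (W : lattice p l) : 'rV[R]_n := sample V s W + u *: w W.
have slopeE i c pi : crystal_slope top c pi i h =
    A0 l i c pi - lower_mx R m *m crystal_diff top c pi i w.
  rewrite /A0 /crystal_slope -opprD -mulmxDr; congr (- (_ *m _)).
  apply/matrixP => a b; rewrite !mxE.
  have : 2 ^+ l != 0 :> R by rewrite expf_neq0 // pnatr_eq0.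
  rewrite /u; move: (2 ^+ l) (sample _ _ _ 0 b) (sample _ _ _ 0 b) (w _ 0 b) (w _ 0 b).
  by move=> k x1 x2 x3 x4 k0; field.
have admP c pi : @cube_simplex R m l c pi `<=` @iota_simplex R m -> adm l c pi.
  by split=> //; exact: leq_maxl.
have dist2 c pi x y : @cube_simplex R m l c pi x -> @cube_simplex R m l c pi y ->
    `|tcoord x - tcoord y| <= 2 * u.
  move=> xc yc; rewrite (le_trans (tcoord_dist _ _)) // ler_wpM2l //.
  exact: cube_dist xc yc.
have val i c pi x y : adm l c pi ->
    @cube_simplex R m l c pi x -> @cube_simplex R m l c pi y ->
    `|pl_map V top h (phi (fun j => V (top i j)) (tcoord x)) - g i (tcoord y)| <= rho / 2.
  move=> [sub _] xc yc; apply: (pl_map_dist cplx sub xc) => t.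
  have cc := corner_cube R c pi t.
  rewrite /h (sample_vertex cplx) (smooth_ext_eq (gs i)); last first.
    by apply: tcoord_std; exact: sub.
  rewrite addrAC (le_trans (ler_normD _ _)) //.
  have : `|g i (tcoord (corner R c pi t)) - g i (tcoord y)| < rho / 4.
    apply: dP; first by apply: tcoord_std; exact: sub.
    by apply: le_lt_trans (dist2 _ _ _ _ cc yc) _; move: ud; lra.
  have : `|u *: w (crystal_vertex top c pi i t)| <= u.
    by rewrite normrZ ger0_norm // ler_piMr.
  by move: urho; lra.
have slope_close i c pi x : adm l c pi -> @cube_simplex R m l c pi x ->
    `|crystal_slope top c pi i h - jac (g i) (tcoord x)| <= eta + eta.
  move=> ha xc; rewrite slopeE addrAC (le_trans (ler_normB _ _)) // lerD //.
    exact: A0_close.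
  by have [] := wP i c pi ha.
exists l, (pl_map V top h); split; first split.
- exact: pl_map_continuous.
- move=> i c pi sub; have [b hb] := pl_map_affine_on cplx h i sub.
  by exists (pinvmx (edge_mx (fun j => V (top i j))) *m crystal_slope top c pi i h), b.
split.
  (* Closeness is demanded for every smooth extension [g']; its values and Jacobian on the simplex
     are those of the chosen [g i]. *)
  move=> i c pi sub v g' g's; have [b hb] := pl_map_affine_on cplx h i sub.
  exists (pinvmx (edge_mx v) *m crystal_slope top c pi i h), b; split=> // t ts [x xc].
  rewrite iota_inv_phi => xt.
  have {xt} tE : t = tcoord x by rewrite -(phiK cplx i t) -xt (phiK cplx).
  split; apply: le_lt_trans (eucl_le _) _.
    rewrite -(smooth_ext_eq g's) // (smooth_ext_eq (gs i)) // distrC tE -/C1.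
    rewrite (@le_lt_trans _ _ (C1 * (rho / 2))) //.
      by rewrite (ler_wpM2l (ltW C10)) //; exact: (val _ _ _ _ _ (admP _ _ sub) xc xc).
    have : C1 * rho <= eps by rewrite mulrC -ler_pdivlMr // ge_min lexx orbT.
    by rewrite mulrA; move: eps0; lra.
  rewrite (edge_slope cplx) (jac_unique g's (gs i)) // distrC tE -/C.
  apply: le_lt_trans etaC; rewrite (ler_wpM2l (ltW C0)) //.
  exact: slope_close (admP _ _ sub) xc.
move=> i c pi sub v; have [b hb] := pl_map_affine_on cplx h i sub.
exists (pinvmx (edge_mx v) *m crystal_slope top c pi i h), b; split=> // z [x xc <-].
rewrite (edge_slope cplx) iota_inv_phi.
have [_ wg] := wP i c pi (admP _ _ sub).
have cc := corner_cube R c pi m; have ha := admP _ _ sub.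
(* Goodness at the jet of the reference corner covers the whole small simplex: point and value stay
   within [r] of those at the corner, and the slope is exactly the good one. *)
apply: wg.
- by apply: tcoord_std; exact: sub.
- by apply: le_lt_trans (dist2 _ _ _ _ xc cc) _; move: ur; lra.
- apply: le_lt_trans (val i c pi x _ ha xc cc) _.
  by have : rho <= r; [rewrite ge_min lexx|move: rho0; lra].
- by rewrite slopeE subrr normr0.
Qed.
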